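(* Let $\beta>0$, $-\beta-1<\alpha<-1$ and $-\alpha\notin\mathbb N$, and let $m\in\mathbb N_0$ and $N\ge1$ be integers with $0\le m\le N$. Suppose that $D_-^{\beta+l}u\in L^2_{\omega^{(\alpha+\beta+l,l)}}(\Lambda)$ for $0\le l\le m$. Then $$\big\|D_-^\beta({}^-\pi_N^{(\alpha,-\beta)}u-u)\big\|_{\omega^{(\alpha+\beta,0)}}\le N^{-m/2}\sqrt{\frac{(N-m+1)!}{(N+1)!}}\;\big\|D_-^{\beta+m}u\big\|_{\omega^{(\alpha+\beta+m,m)}}.$$ In particular, if $m$ is fixed, $$\big\|D_-^\beta({}^-\pi_N^{(\alpha,-\beta)}u-u)\big\|_{\omega^{(\alpha+\beta,0)}}\le cN^{-m}\big\|D_-^{\beta+m}u\big\|_{\omega^{(\alpha+\beta+m,m)}},$$ where the constant $c$ is positive, independent of $u$, and $c\approx1$ for $N\gg1$ (i.e. for fixed $\alpha,\beta,m$ one may take $c=c_N$ with $c_N\to1$ as $N\to\infty$).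
   Context: $\mathbb N=\{1,2,\dots\}$, $\mathbb N_0=\{0\}\cup\mathbb N$, $\Lambda=(-1,1)$, $\omega^{(a,b)}(x)=(1-x)^a(1+x)^b$. For a weight $\varpi>0$ on $\Lambda$, $L^2_\varpi(\Lambda)$ has inner product $(u,v)_\varpi=\int_\Lambda uv\varpi\,dx$ and norm $\|\cdot\|_\varpi$. $\mathcal P_N$ is the set of real polynomials of degree at most $N$. Left Riemann–Liouville derivative: for $s\in[j-1,j)$, $j\in\mathbb N$, $$D_-^sv(x)=\frac{1}{\Gamma(j-s)}\frac{d^j}{dx^j}\int_{-1}^x\frac{v(y)}{(x-y)^{s-j+1}}dy.$$ Let ${}^-\mathcal F_N^{(\alpha,-\beta)}(\Lambda)=\{\phi=(1+x)^\beta\psi:\psi\in\mathcal P_N\}$, and let $\Pi_N^{(\alpha+\beta,0)}:L^2_{\omega^{(\alpha+\beta,0)}}(\Lambda)\to\mathcal P_N$ be the orthogonal projection (note $\alpha+\beta>-1$). For $u$ with $D_-^\beta u\in L^2_{\omega^{(\alpha+\beta,0)}}(\Lambda)$, ${}^-\pi_N^{(\alpha,-\beta)}u$ denotes the unique element of ${}^-\mathcal F_N^{(\alpha,-\beta)}(\Lambda)$ such that $$D_-^\beta({}^-\pi_N^{(\alpha,-\beta)}u)=\Pi_N^{(\alpha+\beta,0)}(D_-^\beta u).$$ *)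

(* Defs.v *)
From HB Require Import structures.
From mathcomp Require Import all_boot all_order all_algebra.
From mathcomp Require Import all_classical all_reals all_analysis.
Set Implicit Arguments.
Unset Strict Implicit.
Unset Printing Implicit Defensive.
Import Order.TTheory GRing.Theory Num.Theory.
Import numFieldNormedType.Exports.
Local Open Scope classical_set_scope.
Local Open Scope ring_scope.

Section Defs.
Variable R : realType.
Local Notation mu := (@lebesgue_measure R).
Implicit Types (a b s x y : R) (v f g : R -> R).

Definition Lam : set R := `]-1, 1[%classic.

Definition jweight a b x : R := (1 - x) `^ a * (1 + x) `^ b.

Definition jdot a b f g : R :=
  \int[mu]_(x in Lam) (f x * g x * jweight a b x).

(* Extended-real valued, so that it is +oo outside of the weighted L^2. *)
Definition jnorm a b f : \bar R :=
  ((\int[mu]_(x in Lam) (f x ^+ 2 * jweight a b x)%:E) `^ (2^-1))%E.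

Definition in_L2 a b f : Prop :=
  measurable_fun Lam f /\ (jnorm a b f < +oo)%E.

Definition Gamma s : R :=
  \int[mu]_(t in `]0, +oo[%classic) (t `^ (s - 1) * expR (- t)).

Definition test_fun (phi : R -> R) : Prop :=
  (forall n x, derivable (phi^`(n))%classic x 1) /\
  exists2 c : R, 0 < c < 1 & forall x, c < `|x| -> phi x = 0.

Definition is_weak_deriv (j : nat) f g : Prop :=
  [/\ locally_integrable Lam f, locally_integrable Lam g &
    forall phi, test_fun phi ->
      \int[mu]_(x in Lam) (f x * (phi^`(j))%classic x) =
      (-1) ^+ j * \int[mu]_(x in Lam) (g x * phi x)].

(* The j in N such that j - 1 <= s < j, for s >= 0. *)
Definition RL_order s : nat := (Num.truncn s).+1.

Definition RL_kernel s x y : R := (x - y) `^ ((RL_order s)%:R - s - 1).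

Definition RL_potential s v x : R :=
  (Gamma ((RL_order s)%:R - s))^-1 *
  \int[mu]_(y in `]-1, x[%classic) (v y * RL_kernel s x y).

(* g represents D_-^s v on (-1, 1): the integral converges for almost every x,
   and d^j/dx^j is taken in the sense of distributions on (-1, 1), as is usual
   for membership of derivatives in weighted L^2 spaces. So g is only
   determined almost everywhere on (-1, 1). *)
Definition is_RLderiv s v g : Prop :=
  {ae mu, forall x, Lam x ->
    mu.-integrable `]-1, x[%classic (fun y => (v y * RL_kernel s x y)%:E)} /\
  is_weak_deriv (RL_order s) (RL_potential s v) g.

Definition RLderivable s v : Prop := exists g, is_RLderiv s v g.

(* A representative of D_-^s v; meaningful only when RLderivable s v. *)
Definition RLderiv s v : R -> R := xget (cst 0) [set g | is_RLderiv s v g].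

Definition RLderiv_in_L2 s v a b : Prop :=
  RLderivable s v /\ in_L2 a b (RLderiv s v).

Definition is_orth_proj (N : nat) a b f (q : {poly R}) : Prop :=
  (size q <= N.+1)%N /\
  forall r : {poly R}, (size r <= N.+1)%N ->
    jdot a b (fun x => f x - q.[x]) (horner r) = 0.

(* Only the values on (-1, 1) matter, hence the restriction to Lam. *)
Definition in_F (N : nat) (beta : R) (p : R -> R) : Prop :=
  exists2 psi : {poly R}, (size psi <= N.+1)%N &
    forall x, Lam x -> p x = (1 + x) `^ beta * psi.[x].

(* p is the projection of u: p is in F_N and D_-^beta p coincides with the
   orthogonal projection of D_-^beta u onto polynomials of degree <= N. *)
Definition is_gjf_proj (N : nat) (alpha beta : R) (u p : R -> R) : Prop :=
  in_F N beta p /\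
  exists2 q : {poly R},
    is_orth_proj N (alpha + beta) 0 (RLderiv beta u) q &
    is_RLderiv beta p (horner q).

End Defs.

(* Main.v *)
Require Import Defs.
From HB Require Import structures.
From mathcomp Require Import all_boot all_order all_algebra.
From mathcomp Require Import all_classical all_reals all_analysis.
From mathcomp Require Import finmap measurable_realfun ring lra.
Set Implicit Arguments.
Unset Strict Implicit.
Unset Printing Implicit Defensive.
Import Order.TTheory GRing.Theory Num.Theory.
Import numFieldNormedType.Exports.
Local Open Scope classical_set_scope.
Local Open Scope ring_scope.

(** Write [f = D^beta u], [a = alpha + beta > -1] and let [Pi_N] be the projection
    in the weight [(a, 0)].  The functions [D^(beta+l) u] are the weak derivatives
    of [f], because all the Riemann-Liouville derivatives involved come from the
    same fractional potential.  Differentiation maps projections to projections: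
    [(Pi_N f)'] is the projection of [f'] of degree [N - 1] in the weight
    [(a+1, 1)], by integration by parts.  With [e = f - Pi_N f], the weighted
    Poincare inequality
      [(N+1) (N+a+b+2) |e|^2_(a,b) <= |e'|^2_(a+1,b+1)]
    follows from the Sturm-Liouville operator [L p = - w^-1 ((1-x^2) w p')']: on
    polynomials orthogonal to degree [<= N] its Rayleigh quotient is at least its
    [(N+1)]-st eigenvalue, the projections [s] of [e] satisfy [|s'| <= |e'|]
    because [<s', s'> = <s, L s> = <e, L s> = <e', s'>], and they converge to [e]
    because polynomials are dense.  Iterating [m] times gives the constant, as
    [(N+1-l) (N+a+2+l) >= N (N+1-l)]. *)

(** * Smooth test functions *)

(** Two obstacles shape the proof. The derivatives are distributional, tested only by functions
    supported away from the endpoints, while each integration by parts involves a polynomial times a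
    weight, which reaches the endpoints and need not be smooth there. That product is therefore
    multiplied by cutoffs built from [exp (-1/t)]. Since the weight [(a+1, b+1)] is [1 - x^2] times
    the weight [(a, b)], the derivative of the cutoff carries a factor that vanishes at both
    endpoints, and no boundary value of [f] is ever needed.

    Moreover [RLderiv] is a choice among functions that agree only almost everywhere, so
    [D^beta (pi_N u - u)] is matched with [Pi_N f - f] through linearity and uniqueness up to null
    sets.

    Jacobi polynomials are never written down: the bound on the Rayleigh quotient uses only the
    symmetry of [L] and its action on leading coefficients. Density is needed only in the norm of
    [e]; the derivatives of the approximants need not approach [e'], since a one-sided bound on them
    suffices. *)

Section Smoothness.
Variable R : realType.
Implicit Types (U V : set R) (f g : R -> R).

(** Relative to a set because powers and weights are smooth only on an open interval, while the test
    functions made from them must be smooth on the whole line. *)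
Fixpoint diff_on U (n : nat) f : Prop :=
  if n is n'.+1 then
    (forall x, U x -> derivable f x 1) /\ diff_on U n' (f^`())%classic
  else True.

Lemma diff_onS U n f : diff_on U n.+1 f -> diff_on U n f.
Proof.
by elim: n f => [|n IH] f //= [df [ddf H]]; split => //; exact: IH.
Qed.

Lemma diff_on_subset U V n f : U `<=` V -> diff_on V n f -> diff_on U n f.
Proof.
by move=> UV; elim: n f => [|n IH] f //= [df H]; split; [move=> x /UV/df|exact: IH].
Qed.

Lemma diff_on_setU U V n f :
  diff_on U n f -> diff_on V n f -> diff_on (U `|` V) n f.
Proof.
elim: n f => [|n IH] f //= [df1 H1] [df2 H2]; split; last exact: IH.
by move=> x [/df1|/df2].
Qed.

Lemma eq_diff_on U n f g : open U -> (forall x, U x -> f x = g x) ->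
  diff_on U n f -> diff_on U n g.
Proof.
move=> oU; elim: n f g => [|n IH] f g fg //= [df H].
have nfg x : U x -> {near x, f =1 g}.
  by move=> Ux; near=> y; apply: fg; near: y; exact: open_nbhs_nbhs.
split; first by move=> x Ux; apply: near_eq_derivable (df x Ux); exact: nfg.
apply: IH H => x Ux; rewrite !derive1E; apply: near_eq_derive.
by have := nfg _ Ux.
Unshelve. all: by end_near. Qed.

Lemma diff_on_cst U n (c : R) : diff_on U n (cst c).
Proof.
elim: n c => [|n IH] c //=; split; first by move=> x _; exact: derivable_cst.
by have -> : ((cst c)^`())%classic = cst (0 : R)
  by apply/funext => x; rewrite derive1_cst.
Qed.

Lemma diff_onD U n f g : open U ->
  diff_on U n f -> diff_on U n g -> diff_on U n (fun x => f x + g x).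
Proof.
move=> oU; elim: n f g => [|n IH] f g //= [df Hf] [dg Hg]; split.
  by move=> x Ux; apply: derivableD; [exact: df|exact: dg].
apply: eq_diff_on (IH _ _ Hf Hg) => // x Ux.
by rewrite !derive1E deriveD//; [exact: df|exact: dg].
Qed.

Lemma diff_onM U n f g : open U ->
  diff_on U n f -> diff_on U n g -> diff_on U n (fun x => f x * g x).
Proof.
move=> oU; elim: n f g => [|n IH] f g // Hf Hg.
have [df Hf'] := Hf; have [dg Hg'] := Hg; split.
  by move=> x Ux; apply: derivableM; [exact: df|exact: dg].
have H := diff_onD oU (IH _ _ (diff_onS Hf) Hg') (IH _ _ (diff_onS Hg) Hf').
apply: eq_diff_on H => // x Ux.
by rewrite !derive1E deriveM//; [exact: df|exact: dg].
Qed.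

Lemma is_derive_affine (c d x : R) : is_derive x 1 (fun x => c * x + d) c.
Proof.
have H : is_derive x 1 ((c \*: id) + cst d) (c *: 1 + 0) by apply: is_deriveD.
by rewrite addr0 [_ *: _]mulr1 in H.
Qed.

Lemma derivable_affine (c d x : R) : derivable (fun x => c * x + d) x 1.
Proof. by have [] := is_derive_affine c d x. Qed.

Lemma diff_on_affine U n f (c d : R) : open U ->
  diff_on U n f ->
  diff_on [set x | U (c * x + d)] n (fun x => f (c * x + d)).
Proof.
move=> oU.
have oV : open [set x | U (c * x + d)].
  apply: (@open_comp _ _ (fun x => c * x + d)) => // x _.
  by apply: differentiable_continuous; apply/derivable1_diffP;
    exact: derivable_affine.
elim: n f => [|n IH] f // [df H]; split.
  move=> x Ux; apply/derivable1_diffP; apply: (@differentiable_comp _ _ _ _ (fun x => c * x + d) f).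
    by apply/derivable1_diffP; exact: derivable_affine.
  by apply/derivable1_diffP; exact: df.
have := diff_onM oV (diff_on_cst _ n c) (IH _ H).
apply: eq_diff_on => // x Ux.
rewrite -[X in _ = (X)^`()%classic _]/(f \o (fun x => c * x + d)).
rewrite [RHS]derive1_comp; last by exact: df.
  by rewrite mulrC [X in _ = _ * X]derive1E; have [_ ->] := is_derive_affine c d x.
exact: derivable_affine.
Qed.

Lemma diff_on_horner U n (p : {poly R}) : diff_on U n (horner p).
Proof.
elim: n p => [|n IH] p //; split; first by move=> x _; exact: derivable_horner.
by rewrite -derivE; exact: IH.
Qed.

Lemma diff_on_powR n (a : R) : diff_on `]0, +oo[ n (@powR R ^~ a).
Proof.
elim: n a => [|n IH] a //; split.
  by move=> x x0; exact: derivable_powR.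
have oU : open (`]0, +oo[%classic : set R) by exact: interval_open.
have := diff_onM oU (diff_on_cst _ n a) (IH (a - 1)).
by apply: eq_diff_on => // x x0; rewrite powR_derive1.
Qed.

Lemma diff_on_derive1n f : (forall n, diff_on setT n f) ->
  forall n x, derivable ((f^`(n))%classic) x 1.
Proof.
move=> H n; have := H n.+1; elim: n f H => [|n IH] f H [df Hn]; first by move=> x; exact: df.
rewrite derive1Sn; apply: IH => // m; by have [] := H m.+1.
Qed.

End Smoothness.

(** * The flat function [exp (-1/t)] and its derivatives *)

Section FlatExponential.
Variable R : realType.
Implicit Types (t y : R).

(* Differentiating [exp (-1/t)] stays in the span of the [t^-j exp (-1/t)], so all
   members are needed for smoothness at [0]. *)
Definition flat_exp (j : nat) t : R :=
  if 0 < t then t^-1 ^+ j * expR (- t^-1) else 0.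

(** A single term of the exponential series suffices: [t^k / k! <= exp t]. *)
Lemma exprn_expRN_le (k : nat) t : 0 <= t -> t ^+ k * expR (- t) <= k`!%:R.
Proof.
move=> t0; rewrite expRN ler_pdivrMr ?expR_gt0//.
case: k => [|k]; first by rewrite expr0 mul1r -expR0 ler_expR.
rewrite mulrC -ler_pdivrMr ?ltr0n ?fact_gt0//.
by apply: le_trans (expR_ge1Dxn k t0); rewrite lerDr.
Qed.

Lemma flat_exp_ge0 j t : 0 <= flat_exp j t.
Proof.
rewrite /flat_exp; case: ifPn => // t0.
by rewrite mulr_ge0 ?expR_ge0// exprn_ge0// invr_ge0 ltW.
Qed.

Lemma flat_exp_le j t : flat_exp j t <= j`!%:R.
Proof.
rewrite /flat_exp; case: ifPn => // t0.
by rewrite exprn_expRN_le// invr_ge0 ltW.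
Qed.

Lemma flat_exp0 j t : t <= 0 -> flat_exp j t = 0.
Proof. by rewrite /flat_exp; case: ltP. Qed.

(** Trades powers of [t] for the index, which turns the uniform bound [flat_exp_le] into vanishing
    to any order at [0]. *)
Lemma flat_exp_shift j k t : t ^+ k * flat_exp (k + j) t = flat_exp j t.
Proof.
rewrite /flat_exp; case: ifPn => t0; last by rewrite mulr0.
by rewrite exprD !mulrA -exprMn divff ?gt_eqF// expr1n mul1r.
Qed.

Lemma is_derive_flat_exp j t :
  is_derive t 1 (flat_exp j) (flat_exp j.+2 t - j%:R * flat_exp j.+1 t).
Proof.
case: (ltgtP t 0) => [t0|t0|->].
- rewrite !flat_exp0 ?ltW// mulr0 subr0.
  apply: (@near_eq_is_derive _ _ _ (cst (0 : R))).
  by near=> y; rewrite flat_exp0// ltW//; near: y; exact: lt_nbhsl.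
- pose g y : R := y^-1 ^+ j * expR (- y^-1).
  apply: (@near_eq_is_derive _ _ _ g).
    by near=> y; rewrite /flat_exp ifT//; near: y; exact: lt_nbhsr.
  have d1 : is_derive t 1 (fun y : R => y^-1) (- t ^- 2).
    have := @is_deriveV _ id t 1 1 _ (is_derive_id t 1).
    by rewrite [_ *: _]mulr1; apply; rewrite gt_eqF.
  have d2 : is_derive t 1 (fun y : R => expR (- y^-1)) (expR (- t^-1) * t ^- 2).
    have d3 : is_derive t 1 (fun y : R => - y^-1) (t ^- 2).
      by have := is_deriveN d1; rewrite opprK.
    exact: (@is_derive1_comp _ expR _ t _ _ (is_derive_expR _) d3).
  have d4 : is_derive t 1 (fun y : R => y^-1 ^+ j)
     ((j%:R * t^-1 ^+ j.-1) * (- t ^- 2)).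
    apply: (@is_derive1_comp _ (fun y => y ^+ j) _ t _ _ _ d1).
    apply: DeriveDef; first exact: exprn_derivable.
    by rewrite exp_derive [_ *: _]mulr1.
  have d5 : is_derive t 1 g _ := is_deriveM d4 d2.
  apply: is_derive_eq d5 _.
  rewrite /flat_exp t0 /GRing.scale/= -!exprVn.
  have tn0 : t != 0 by rewrite gt_eqF.
  case: j {d4 g} => [|j]; first by rewrite /= expr0 !exprVn; ring.
  by rewrite /= !exprS ; ring.
- rewrite !flat_exp0// mulr0 subr0.
  have H : (fun h : R => h^-1 *: ((flat_exp j \o shift 0) (h *: (1 : R)) - flat_exp j 0)) @ 0^' --> (0 : R).
    apply/cvgr0Pnorm_le => e e0; near=> h.
    rewrite /= addr0 [h *: _]mulr1 (flat_exp0 _ (lexx 0)) subr0 normrM normfV.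
    have h0 : h != 0 by near: h; exact: nbhs_dnbhs_neq.
    rewrite mulrC ler_pdivrMr ?normr_gt0//.
    (* [flat_exp j h] is [h^2] times the bounded [flat_exp (2 + j) h], so the difference quotient at
       [0] is [O(h)]. *)
    rewrite -(@flat_exp_shift j 2) normrM normrX expr2 -mulrA mulrC.
    rewrite ler_wpM2r//.
    have -> : `|flat_exp (2 + j) h| = flat_exp (2 + j) h by rewrite ger0_norm ?flat_exp_ge0.
    apply: (@le_trans _ _ (`|h| * (2 + j)`!%:R)); first by rewrite ler_wpM2l ?flat_exp_le.
    rewrite -ler_pdivlMr ?ltr0n ?fact_gt0//.
    near: h; apply: dnbhs0_le; by rewrite divr_gt0 ?ltr0n ?fact_gt0.
  by apply: DeriveDef; [apply/cvg_ex; exists 0|exact: cvg_lim H].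
Unshelve. all: by end_near. Qed.

Lemma diff_on_flat_exp n j : diff_on setT n (flat_exp j).
Proof.
elim: n j => [|n IH] j //; split.
  by move=> t _; have [] := is_derive_flat_exp j t.
have := diff_onD openT (IH j.+2) (diff_onM openT (diff_on_cst _ n (- j%:R)) (IH j.+1)).
apply: eq_diff_on openT _ => t _.
by rewrite derive1E; have [_ ->] := is_derive_flat_exp j t; rewrite /= mulNr.
Qed.

Lemma cvg_affine_pinfty (y : R) : 0 < y ->
  k%:R * y - 1 @[k --> \oo] --> +oo.
Proof.
move=> y0; apply/cvgryPge => A; near=> k.
rewrite lerBrDr -ler_pdivrMr//; near: k; exact: nbhs_infty_ger.
Unshelve. all: by end_near. Qed.

Let cvg_inv (y : R) : 0 < y -> (k%:R * y - 1)^-1 @[k --> \oo] --> (0 : R).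
Proof.
move=> y0; apply/gtr0_cvgV0; last exact: cvg_affine_pinfty.
have /cvgryPgt := cvg_affine_pinfty y0; exact.
Qed.

Let near_pos (y : R) : 0 < y -> \forall k \near \oo, 0 < k%:R * y - 1.
Proof. move=> y0; have /cvgryPgt := cvg_affine_pinfty y0; exact. Qed.

Lemma flat_exp_cvg1 (y : R) : 0 < y ->
  flat_exp 0 (k%:R * y - 1) @[k --> \oo] --> (1 : R).
Proof.
move=> y0.
have H : expR (- (k%:R * y - 1)^-1) @[k --> \oo] --> (1 : R).
  rewrite -[X in _ --> X]expR0; apply: continuous_cvg; first exact: continuous_expR.
  by rewrite -[X in _ --> X]oppr0; apply: cvgN; exact: cvg_inv.
apply: cvg_trans H; apply: near_eq_cvg; near=> k.
rewrite /flat_exp expr0 mul1r ifT//; near: k; exact: near_pos.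
Unshelve. all: by end_near. Qed.

Lemma flat_exp_leV j t : 0 < t -> flat_exp j t <= t^-1 ^+ j.
Proof.
move=> t0; rewrite /flat_exp t0 ler_piMr ?exprn_ge0 ?invr_ge0 ?ltW//.
by rewrite expR_lt1 oppr_lt0 invr_gt0.
Qed.

(** As [flat_exp 2] is the derivative of [flat_exp 0], for [t = k y - 1] the left side is [y] times
    the derivative in [y] of [flat_exp 0 (k y - 1)]: the slope of a cutoff weighted by the distance
    to the endpoint. The right side shows that it is bounded and decays like [1/t]. *)
Lemma flat_exp_deriv_eq t : (t + 1) * flat_exp 2 t = flat_exp 1 t + flat_exp 2 t.
Proof. by rewrite mulrDl mul1r -(@flat_exp_shift 1 1) expr1. Qed.

Lemma flat_exp_deriv_le t : (t + 1) * flat_exp 2 t <= 3.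
Proof.
by rewrite flat_exp_deriv_eq (@le_trans _ _ (1`!%:R + 2`!%:R))// ?lerD ?flat_exp_le//.
Qed.

Lemma flat_exp_deriv_ge0 t : 0 <= (t + 1) * flat_exp 2 t.
Proof.
case: (lerP t 0) => t0; first by rewrite flat_exp0// mulr0.
by rewrite mulr_ge0 ?flat_exp_ge0// addr_ge0 ?ltW.
Qed.

Lemma flat_exp_deriv_cvg0 (y : R) : 0 < y ->
  k%:R * y * flat_exp 2 (k%:R * y - 1) @[k --> \oo] --> (0 : R).
Proof.
move=> y0; pose s (k : nat) : R := (k%:R * y - 1)^-1.
have s0 : s @ \oo --> (0 : R) by exact: cvg_inv.
have H : s k + s k * s k @[k --> \oo] --> (0 : R).
  by rewrite -[X in _ --> X]addr0 -{2}(mulr0 0); apply: cvgD => //; apply: cvgM.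
apply: (@squeeze_cvgr _ _ _ _ (cst 0) _ _ _ _ _ H); last exact: cvg_cst.
near=> k; apply/andP; split.
  by have := flat_exp_deriv_ge0 (k%:R * y - 1); rewrite subrK.
have t0 : 0 < k%:R * y - 1 by near: k; exact: near_pos.
have : (k%:R * y - 1 + 1) * flat_exp 2 (k%:R * y - 1) <= s k + s k * s k.
  by rewrite flat_exp_deriv_eq lerD// (le_trans (flat_exp_leV _ t0))// ?expr1 ?expr2.
by rewrite subrK.
Unshelve. all: by end_near. Qed.

End FlatExponential.

(** * Cutoffs and test functions *)

Section TestFunctions.
Variable R : realType.
Implicit Types (c d x : R) (rho phi : R -> R) (k : nat).

(** For [k > 0] the shift by [-1] makes it vanish already for [x <= c + 1/k] and for [x >= d - 1/k],
    so that the support is compact in the open interval even when [c = -1] and [d = 1]. *)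
Definition cutoff c d k x : R :=
  flat_exp 0 (k%:R * (x - c) - 1) * flat_exp 0 (k%:R * (d - x) - 1).

Lemma diff_on_cutoff n c d k : diff_on setT n (cutoff c d k).
Proof.
have H a b : diff_on setT n (fun x => flat_exp 0 (a * x + b)).
  have := diff_on_affine a b openT (@diff_on_flat_exp R n 0).
  by apply: diff_on_subset.
have := diff_onM openT (H k%:R (- (k%:R * c + 1))) (H (- k%:R) (k%:R * d - 1)).
apply: eq_diff_on openT _ => x _; rewrite /cutoff.
by congr (flat_exp _ _ * flat_exp _ _); ring.
Qed.

Lemma cutoff_ge0 c d k x : 0 <= cutoff c d k x.
Proof. by rewrite mulr_ge0 ?flat_exp_ge0. Qed.

Lemma cutoff_le1 c d k x : cutoff c d k x <= 1.
Proof. by rewrite mulr_ile1 ?flat_exp_ge0 ?flat_exp_le. Qed.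

(** The radius [1 - 1/(k+2)] lies strictly between [0] and [1] for every [k], [0] included, as
    [test_fun] demands. *)
Lemma cutoff_eq0 c d k x : -1 <= c -> d <= 1 ->
  1 - k.+2%:R^-1 <= `|x| -> cutoff c d k x = 0.
Proof.
move=> c1 d1 xk.
have H (y : R) : y <= k.+2%:R^-1 -> k%:R * y - 1 <= 0.
  move=> yk; rewrite subr_le0 (@le_trans _ _ (k%:R * k.+2%:R^-1))//.
    by rewrite ler_wpM2l.
  by rewrite ler_pdivrMr ?ltr0n// mul1r ler_nat; apply: (leq_trans (leqnSn k)); exact: leqnSn.
move: xk H; set e : R := k.+2%:R^-1 => xk H.
rewrite /cutoff; have [x0|x0] := leP 0 x.
  rewrite (@flat_exp0 _ _ (k%:R * (d - x) - 1)) ?mulr0// H//.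
  by move: xk; rewrite ger0_norm//; lra.
rewrite (@flat_exp0 _ _ (k%:R * (x - c) - 1)) ?mul0r// H//.
by move: xk; rewrite ltr0_norm//; lra.
Qed.

Lemma cutoff_out c d k x : x <= c \/ d <= x -> cutoff c d k x = 0.
Proof.
have H (y : R) : y <= 0 -> k%:R * y - 1 <= 0.
  move=> yk; have : k%:R * y <= 0 by rewrite mulr_ge0_le0.
  lra.
move=> [xc|dx]; rewrite /cutoff.
  by rewrite flat_exp0 ?mul0r// H// subr_le0.
by rewrite mulrC flat_exp0 ?mul0r// H// subr_le0.
Qed.

Lemma cutoff_cvg1 c d x : c < x < d -> cutoff c d k x @[k --> \oo] --> (1 : R).
Proof.
move=> /andP[cx xd]; rewrite -[X in _ --> X]mulr1.
by apply: cvgM; apply: flat_exp_cvg1; rewrite subr_gt0.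
Qed.

Lemma cutoff_cvg_indic c d x :
  cutoff c d k x @[k --> \oo] --> (\1_(`]c, d[) x : R).
Proof.
rewrite indicE mem_setE in_itv/=; case: (boolP (c < x < d)) => [cxd|].
  exact: cutoff_cvg1.
rewrite negb_and -!leNgt => /orP cxd.
by under eq_fun do rewrite cutoff_out//; exact: cvg_cst.
Qed.

Lemma is_derive_cutoff k x : is_derive x 1 (cutoff (-1) 1 k)
  (k%:R * flat_exp 2 (k%:R * (1 + x) - 1) * flat_exp 0 (k%:R * (1 - x) - 1)
   - flat_exp 0 (k%:R * (1 + x) - 1) * (k%:R * flat_exp 2 (k%:R * (1 - x) - 1))).
Proof.
have H a b : is_derive x 1 (fun x => flat_exp 0 (a * x + b)) (a * flat_exp 2 (a * x + b)).
  rewrite mulrC; apply: (@is_derive1_comp _ (flat_exp 0) (fun x => a * x + b)).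
    have := is_derive_flat_exp 0 (a * x + b); by rewrite mul0r subr0.
  exact: is_derive_affine.
have D := is_deriveM (H k%:R (k%:R - 1)) (H (- k%:R) (k%:R - 1)).
have e1 : k%:R * x + (k%:R - 1) = k%:R * (1 + x) - 1 by ring.
have e2 : - k%:R * x + (k%:R - 1) = k%:R * (1 - x) - 1 by ring.
have -> : cutoff (-1) 1 k = (fun x => flat_exp 0 (k%:R * x + (k%:R - 1))) *
    (fun x => flat_exp 0 (- k%:R * x + (k%:R - 1))).
  apply/funext => y; rewrite /cutoff; transitivity
    (flat_exp 0 (k%:R * y + (k%:R - 1)) * flat_exp 0 (- k%:R * y + (k%:R - 1))) => //.
  by congr (flat_exp _ _ * flat_exp _ _); ring.
apply: is_derive_eq D _; rewrite e1 e2 /GRing.scale/=; ring.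
Qed.

(** [rho] may be singular at the endpoints: the product is smooth on [Lam] and vanishes identically
    on the open set [V], and these two sets cover the line. *)
Lemma test_fun_cutoff rho c d k : -1 <= c -> d <= 1 ->
  (forall n, diff_on (@Lam R) n rho) -> test_fun (fun x => rho x * cutoff c d k x).
Proof.
move=> c1 d1 Hrho.
have k0 : 0 < 1 - k.+2%:R^-1 :> R by rewrite subr_gt0 invf_lt1// ltr1n.
have k1 : 1 - k.+2%:R^-1 < 1 :> R by rewrite ltrBlDr ltrDl invr_gt0.
split; last first.
  exists (1 - k.+2%:R^-1); first by rewrite k0.
  by move=> x xk; rewrite cutoff_eq0 ?mulr0// ltW.
apply: diff_on_derive1n => n.
pose V : set R := (fun x : R => `|x|) @^-1` [set y | 1 - k.+2%:R^-1 < y].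
have oV : open V.
  by apply: open_comp => [x _|]; [exact: norm_continuous|exact: open_gt].
have oL : open (@Lam R) by exact: interval_open.
have -> : setT = @Lam R `|` V.
  apply/esym/seteqP; split => // x _.
  case: (ltP `|x| 1) => x1; first by left; rewrite /Lam /= in_itv/= -ltr_norml.
  by right; rewrite /V/= (lt_le_trans k1).
apply: diff_on_setU.
  apply: diff_onM => //; apply: diff_on_subset (diff_on_cutoff _ _ _ _); exact: subsetT.
apply: eq_diff_on oV _ (diff_on_cst _ n 0) => x Vx.
by rewrite cutoff_eq0 ?mulr0// ltW.
Qed.

Lemma derive1_test_fun phi : test_fun phi -> test_fun (phi^`())%classic.
Proof.
move=> [dphi [c c01 phi0]]; split.
  by move=> n x; rewrite -derive1Sn; exact: dphi.
exists c => // x cx; rewrite derive1E (@near_eq_derive _ _ _ _ (cst 0)).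
  by rewrite derive_cst.
have oV : open ((fun x : R => `|x|) @^-1` [set y | c < y]).
  by apply: open_comp => [y _|]; [exact: norm_continuous|exact: open_gt].
by near=> y; apply: phi0; near: y; exact: open_nbhs_nbhs.
Unshelve. all: by end_near. Qed.

Lemma derive1n_test_fun phi n : test_fun phi -> test_fun (phi^`(n))%classic.
Proof.
by move=> tphi; elim: n => [//|n IH]; rewrite derive1nS; exact: derive1_test_fun.
Qed.

Lemma test_fun_continuous phi : test_fun phi -> continuous phi.
Proof.
move=> [dphi _] x; apply: differentiable_continuous; apply/derivable1_diffP.
exact: (dphi 0%N).
Qed.

Lemma test_fun_bounded phi : test_fun phi -> exists M, forall x, `|phi x| <= M.
Proof.
move=> tphi; have cphi := test_fun_continuous tphi.
have [_ [c /andP[c0 c1] phi0]] := tphi.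
have c11 : - 1 <= 1 :> R by lra.
have [|z _ Hz] := @EVT_max R (fun x => `|phi x|) (-1) 1 c11.
  apply: continuous_subspaceT => x; apply: continuous_comp; first exact: cphi.
  exact: norm_continuous.
exists (Num.max `|phi z| 0) => x; rewrite le_max; case: (ltP c `|x|) => cx.
  by rewrite phi0// normr0 lexx orbT.
by rewrite Hz// in_itv/= -ler_norml (le_trans cx)// ltW.
Qed.

End TestFunctions.

(** * Weighted square-integrable functions *)

Section IntegralLam.
Variable R : realType.
Local Notation mu := (@lebesgue_measure R).
Implicit Types (D : set (measurableTypeR R)) (f g h : R -> R).

(* The two measurable structures on [R], with and without [measurableTypeR], have
   the same sets but different displays; [lebesgue_measure] lives on this one. *)
Lemma measurable_Lam : measurable (@Lam R : set (measurableTypeR R)).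
Proof. exact: measurable_itv. Qed.

Lemma measurable_fun_Lam f : continuous f -> measurable_fun (@Lam R) f.
Proof.
by move=> cf; apply: measurable_funTS; exact: continuous_measurable_fun.
Qed.

Lemma ae_mono (P Q : R -> Prop) : (forall x, P x -> Q x) ->
  {ae mu, forall x, P x} -> {ae mu, forall x, Q x}.
Proof. by move=> PQ; apply: filterS => //; exact: (ae_filter_ringOfSetsType mu). Qed.

Lemma ae_mono2 (P Q S : R -> Prop) : (forall x, P x -> Q x -> S x) ->
  {ae mu, forall x, P x} -> {ae mu, forall x, Q x} -> {ae mu, forall x, S x}.
Proof. by move=> PQ; apply: filterS2 => //; exact: (ae_filter_ringOfSetsType mu). Qed.

Lemma integrable_le D f g : measurable D -> measurable_fun D f ->
  mu.-integrable D (EFin \o g) -> (forall x, D x -> `|f x| <= g x) ->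
  mu.-integrable D (EFin \o f).
Proof.
move=> mD mf ig fg; apply: le_integrable ig => //; first exact/measurable_EFinP.
move=> x Dx; rewrite /= lee_fin (le_trans (fg _ Dx))//; exact: ler_norm.
Qed.

Lemma RintegrableD D f g : measurable D -> mu.-integrable D (EFin \o f) ->
  mu.-integrable D (EFin \o g) -> mu.-integrable D (EFin \o (fun x => f x + g x)).
Proof.
by move=> mD if_ ig; have := integrableD mD if_ ig; apply: eq_integrable.
Qed.

Lemma RintegrableZ D (c : R) f : measurable D -> mu.-integrable D (EFin \o f) ->
  mu.-integrable D (EFin \o (fun x => c * f x)).
Proof. by move=> mD if_; have := integrableZl mD c if_; apply: eq_integrable. Qed.

Lemma eq_Rintegrable D f g : measurable D -> (forall x, D x -> f x = g x) ->
  mu.-integrable D (EFin \o f) -> mu.-integrable D (EFin \o g).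
Proof.
by move=> mD fg; apply: eq_integrable => // x /set_mem Dx; rewrite /= fg.
Qed.

Lemma cvg_Rintegral D (F : nat -> R -> R) f g : measurable D ->
  (forall n, measurable_fun D (F n)) -> measurable_fun D f ->
  {ae mu, forall x, D x -> F ^~ x @ \oo --> f x} ->
  mu.-integrable D (EFin \o g) -> (forall n x, D x -> `|F n x| <= g x) ->
  \int[mu]_(x in D) F n x @[n --> \oo] --> \int[mu]_(x in D) f x.
Proof.
move=> mD mF mf Ff ig Fg.
have iF n : mu.-integrable D (EFin \o F n).
  by apply: (integrable_le mD _ ig) => // x; exact: Fg.
have [|||||] := @dominated_convergence _ _ R mu D mD
  (fun n => EFin \o F n) (EFin \o f) (EFin \o g).
- by move=> n; apply/measurable_EFinP; exact: mF.
- exact/measurable_EFinP.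
- by apply: ae_mono Ff => x Ff Dx; apply: cvg_EFin; [exact: nearW|exact: Ff].
- exact: ig.
- by apply/aeW => x n Dx; rewrite /= lee_fin; exact: Fg.
move=> if_ _ H; apply: fine_cvg; rewrite fineK; first exact: H.
exact: integrable_fin_num.
Qed.

End IntegralLam.

Section WeightedL2.
Variable R : realType.
Local Notation mu := (@lebesgue_measure R).
Variable w : R -> R.
Hypothesis mw : measurable_fun (@Lam R) w.
Hypothesis w_ge0 : forall x, Lam x -> 0 <= w x.
Hypothesis iw : mu.-integrable (@Lam R) (EFin \o w).
Implicit Types (f g h : R -> R) (p q r : {poly R}).

Definition wL2 f := measurable_fun (@Lam R) f /\
  mu.-integrable (@Lam R) (EFin \o (fun x => f x ^+ 2 * w x)).

Definition wdot f g : R := \int[mu]_(x in @Lam R) (f x * g x * w x).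

Let mL := @measurable_Lam R.

Lemma wL2M f g : wL2 f -> wL2 g ->
  mu.-integrable (@Lam R) (EFin \o (fun x => f x * g x * w x)).
Proof.
move=> [mf if_] [mg ig].
apply: (integrable_le (g := fun x => f x ^+ 2 * w x + g x ^+ 2 * w x)) => //.
- by apply: measurable_funM => //; exact: measurable_funM.
- exact: RintegrableD.
move=> x Lx; rewrite !normrM (ger0_norm (w_ge0 Lx)) -mulrDl ler_wpM2r ?w_ge0//.
rewrite -(real_normK (num_real (f x))) -(real_normK (num_real (g x))).
have := sqr_ge0 (`|f x| - `|g x|); have := sqr_ge0 (`|f x| + `|g x|).
by rewrite sqrrD sqrrB; nra.
Qed.

Lemma wL2D f g : wL2 f -> wL2 g -> wL2 (fun x => f x + g x).
Proof.
move=> Hf Hg; have [mf if_] := Hf; have [mg ig] := Hg; split.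
  exact: measurable_funD.
have i2 := RintegrableZ 2 mL (wL2M Hf Hg).
have := RintegrableD mL (RintegrableD mL if_ ig) i2.
by apply: eq_Rintegrable => // x _; ring.
Qed.

Lemma wL2Z c f : wL2 f -> wL2 (fun x => c * f x).
Proof.
move=> [mf if_]; split; first exact: measurable_funM.
have := RintegrableZ (c ^+ 2) mL if_.
by apply: eq_Rintegrable => // x _; ring.
Qed.

Lemma wL2B f g : wL2 f -> wL2 g -> wL2 (fun x => f x - g x).
Proof.
move=> Hf /(wL2Z (-1)) /(wL2D Hf).
by rewrite (_ : (fun x => _) = (fun x => f x - g x))//; apply/funext => x; ring.
Qed.

Lemma bounded_wL2 f (M : R) : measurable_fun (@Lam R) f ->
  (forall x, Lam x -> `|f x| <= M) -> wL2 f.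
Proof.
move=> mf fM; split => //.
apply: (integrable_le (g := fun x => M ^+ 2 * w x)) => //.
- by apply: measurable_funM => //; exact: measurable_funX.
- exact: RintegrableZ.
move=> x Lx; rewrite normrM (ger0_norm (w_ge0 Lx)) ler_wpM2r ?w_ge0//.
by rewrite normrX lerXn2r// ?nnegrE ?fM// (le_trans _ (fM _ Lx)).
Qed.

Lemma horner_bounded p : exists M : R, forall x, Lam x -> `|p.[x]| <= M.
Proof.
exists (\sum_(i < size p) `|p`_i|) => x; rewrite /Lam/= in_itv/= -ltr_norml => x1.
rewrite horner_coef (le_trans (ler_norm_sum _ _ _))// ler_sum// => i _.
by rewrite normrM normrX ler_piMr// exprn_ile1// ltW.
Qed.

Lemma horner_wL2 p : wL2 (horner p).
Proof.
have [M pM] := horner_bounded p; apply: bounded_wL2 pM.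
by apply: measurable_fun_Lam; exact: continuous_horner.
Qed.

Lemma wdotC f g : wdot f g = wdot g f.
Proof. by apply: eq_Rintegral => x _; rewrite (mulrC (f x)). Qed.

Lemma wdotDl f g h : wL2 f -> wL2 g -> wL2 h ->
  wdot (fun x => f x + g x) h = wdot f h + wdot g h.
Proof.
move=> Hf Hg Hh; rewrite -RintegralD//; [|exact: wL2M..].
by apply: eq_Rintegral => x _; rewrite !mulrDl.
Qed.

Lemma wdotZl c f h : wL2 f -> wL2 h ->
  wdot (fun x => c * f x) h = c * wdot f h.
Proof.
move=> Hf Hh; rewrite -RintegralZl//; last exact: wL2M.
by apply: eq_Rintegral => x _; rewrite !mulrA.
Qed.

Lemma wdotBl f g h : wL2 f -> wL2 g -> wL2 h ->
  wdot (fun x => f x - g x) h = wdot f h - wdot g h.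
Proof.
move=> Hf Hg Hh; rewrite -RintegralB//; [|exact: wL2M..].
by apply: eq_Rintegral => x _; rewrite !mulrBl.
Qed.

Lemma wdotDr f g h : wL2 f -> wL2 g -> wL2 h ->
  wdot h (fun x => f x + g x) = wdot h f + wdot h g.
Proof. by move=> *; rewrite wdotC wdotDl// !(wdotC h). Qed.

Lemma wdotZr c f h : wL2 f -> wL2 h ->
  wdot h (fun x => c * f x) = c * wdot h f.
Proof. by move=> *; rewrite wdotC wdotZl// (wdotC h). Qed.

Lemma wdotBr f g h : wL2 f -> wL2 g -> wL2 h ->
  wdot h (fun x => f x - g x) = wdot h f - wdot h g.
Proof. by move=> *; rewrite wdotC wdotBl// !(wdotC h). Qed.

Lemma wdot_ge0 f : 0 <= wdot f f.
Proof.
apply: Rintegral_ge0 => x Lx; rewrite mulr_ge0 ?w_ge0//; exact: sqr_ge0.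
Qed.

Lemma eq_wdot f f' g g' : (forall x, f x = f' x) -> (forall x, g x = g' x) ->
  wdot f g = wdot f' g'.
Proof. by move=> /funext -> /funext ->. Qed.

Lemma wdot_sqrB f g : wL2 f -> wL2 g ->
  wdot (fun x => f x - g x) (fun x => f x - g x)
  = wdot f f - 2 * wdot f g + wdot g g.
Proof.
move=> Hf Hg; have Hfg := wL2B Hf Hg.
rewrite wdotBl// wdotBr// wdotBr// (wdotC g f); ring.
Qed.

(** The degenerate case of Cauchy-Schwarz. The weight is only assumed nonnegative, so a nonzero
    polynomial may have norm [0]. *)
Lemma wdot_eq0 f g : wL2 f -> wL2 g -> wdot g g = 0 -> wdot f g = 0.
Proof.
move=> Hf Hg g0; apply/eqP; apply: contraT => fg0.
(* Since [g] has norm [0], this [t] gives [f - t g] the squared norm [-1]. *)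
pose t := (wdot f f + 1) / (2 * wdot f g).
have := wdot_ge0 (fun x => f x - t * g x).
rewrite wdot_sqrB//; last exact: wL2Z.
rewrite wdotZr// wdotZr//; last exact: wL2Z.
rewrite wdotZl// g0 !mulr0 addr0 mulrA (mulrC 2) /t -mulrA.
by rewrite mulfVK ?mulf_neq0//; lra.
Qed.

(** Gram-Schmidt, one degree at a time: [J] is [X^n] minus its own projection, hence monic and
    orthogonal to all lower degrees. *)
Lemma orth_proj_exists n f : wL2 f ->
  exists2 q : {poly R}, (size q <= n)%N &
    forall r : {poly R}, (size r <= n)%N -> wdot (fun x => f x - q.[x]) (horner r) = 0.
Proof.
elim: n f => [|n IH] f Hf.
  exists 0; first by rewrite size_poly0.
  move=> r; rewrite leqn0 size_poly_eq0 => /eqP ->.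
  rewrite /wdot; under eq_Rintegral do rewrite horner0 mulr0 mul0r.
  by rewrite Rintegral_cst// mul0r.
have [s ss Hs] := IH _ (horner_wL2 'X^n).
have [q sq Hq] := IH _ Hf.
pose J := 'X^n - s; have HJ := horner_wL2 J.
have JE x : J.[x] = ('X^n).[x] - s.[x] by rewrite hornerD hornerN.
have HJr r : (size r <= n)%N -> wdot (horner J) (horner r) = 0.
  by move=> sr; rewrite -(Hs r sr); exact: eq_wdot.
pose c := wdot f (horner J) / wdot (horner J) (horner J).
have Hc : c * wdot (horner J) (horner J) = wdot f (horner J).
  have [J0|J0] := eqVneq (wdot (horner J) (horner J)) 0; last by rewrite divfK.
  by rewrite J0 mulr0 wdot_eq0.
have sJ : (size J <= n.+1)%N.
  by rewrite (leq_trans (size_polyD _ _))// geq_max size_polyN size_polyXn leqnn/= ltnW.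
(* If [J] has norm 0 then [c = 0] by the convention [x / 0 = 0], as it should. *)
exists (q + c *: J).
  rewrite (leq_trans (size_polyD _ _))// geq_max (leq_trans sq)//=.
  exact: (leq_trans (size_scale_leq _ _)).
have Hfq : wL2 (fun x => f x - (q + c *: J).[x]) by apply: wL2B => //; exact: horner_wL2.
have Hfq' : wL2 (fun x => f x - q.[x]) by apply: wL2B => //; exact: horner_wL2.
have E g : wL2 g -> wdot (fun x => f x - (q + c *: J).[x]) g =
    wdot (fun x => f x - q.[x]) g - c * wdot (horner J) g.
  move=> Hg; rewrite -wdotZl// -wdotBl//; last exact: wL2Z.
  by apply: eq_wdot => // x; rewrite hornerD hornerZ; ring.
have E1 r : (size r <= n)%N -> wdot (fun x => f x - (q + c *: J).[x]) (horner r) = 0.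
  by move=> sr; rewrite E ?Hq ?HJr ?mulr0 ?subr0//; exact: horner_wL2.
move=> r sr.
(* As [J] is monic of degree [n], this lowers the degree of [r] and leaves only multiples of [J] to
   be tested. *)
pose r' := r - r`_n *: J.
have sr' : (size r' <= n)%N.
  apply/leq_sizeP => j nj; rewrite /r' coefB coefZ coefB coefXn.
  rewrite (nth_default 0 (leq_trans ss nj)) subr0.
  move: nj; rewrite leq_eqVlt => /predU1P[<-|nj].
    by rewrite eqxx mulr1 subrr.
  by rewrite (nth_default 0 (leq_trans sr nj)) gtn_eqF// mulr0 subr0.
have rE x : r.[x] = r'.[x] + r`_n * J.[x] by rewrite /r' hornerD hornerN hornerZ subrK.
rewrite (eq_wdot (f' := fun x => f x - (q + c *: J).[x]) _ rE)//.
rewrite wdotDr//; [|exact: horner_wL2|by apply: wL2Z].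
rewrite E1// add0r wdotZr// E// wdotBl//; last exact: horner_wL2.
by rewrite (wdotC (horner q)) HJr// Hc !subr0 subrr mulr0.
Qed.

End WeightedL2.

(** * Density of polynomials *)

Section StepApproximation.
Variable R : realType.
Implicit Types (y t g : R).

Lemma bernoulli_ge y K : 0 <= y <= 1 -> 1 - K%:R * y <= (1 - y) ^+ K.
Proof.
move=> /andP[y0 y1]; elim: K => [|K IH]; first by rewrite mul0r subr0 expr0.
rewrite exprS; apply: (@le_trans _ _ ((1 - y) * (1 - K%:R * y))).
  rewrite -natr1; have : 0 <= K%:R * y * y by rewrite !mulr_ge0.
  by nra.
by rewrite ler_wpM2l// subr_ge0.
Qed.

Lemma bernoulli_le y K : 0 <= y <= 1 -> (1 - y) ^+ K * (1 + K%:R * y) <= 1.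
Proof.
move=> /andP[y0 y1]; elim: K => [|K IH]; first by rewrite mul0r addr0 expr0 mulr1.
apply: le_trans IH; rewrite exprSr -mulrA ler_wpM2l ?exprn_ge0 ?subr_ge0//.
rewrite -natr1; have : 0 <= K%:R * y * y by rewrite !mulr_ge0.
by nra.
Qed.

(* Tends boundedly to the indicator of [t < g], up to the point [t = g]. *)
Definition step_seq g t (n : nat) : R := (1 - t ^+ n) ^+ (Num.truncn (g ^- n)).+1.

Lemma step_seq_ge0_le1 g t n : 0 < t < 1 -> 0 <= step_seq g t n <= 1.
Proof.
move=> /andP[t0 t1].
have tn : 0 <= t ^+ n <= 1 by rewrite exprn_ge0 ?exprn_ile1// ltW.
move: tn => /andP[tn0 tn1]; rewrite /step_seq.
by rewrite exprn_ge0 ?exprn_ile1 ?subr_ge0// lerBlDr lerDl.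
Qed.

(** The exponent [K] is at most [g^-n + 1], so by Bernoulli the value differs from [1] by at most
    [K t^n <= (t/g)^n + t^n]. *)
Lemma step_seq_cvg1 g t : 0 < t < g -> g < 1 -> step_seq g t @ \oo --> (1 : R).
Proof.
move=> /andP[t0 tg] g1; have g0 := lt_trans t0 tg; have t1 := lt_trans tg g1.
have H : 1 - ((t / g) ^+ n + t ^+ n) @[n --> \oo] --> (1 : R).
  rewrite -[X in _ --> X]subr0 -[X in _ --> _ - X]addr0.
  apply: cvgB; [exact: cvg_cst|apply: cvgD; apply: cvg_expr].
    by rewrite ger0_norm ?divr_ge0 ?ltW// ltr_pdivrMr// mul1r.
  by rewrite ger0_norm ?ltW.
apply: (@squeeze_cvgr _ _ _ _ _ (cst 1) _ _ _ H); last exact: cvg_cst.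
apply: nearW => n.
have /andP[_ sn] : 0 <= step_seq g t n <= 1 by apply: step_seq_ge0_le1; rewrite t0.
rewrite sn andbT; apply: le_trans (bernoulli_ge _ _); last first.
  by rewrite exprn_ge0 ?exprn_ile1// ltW.
rewrite lerB// expr_div_n -natr1 mulrDl mul1r lerD2r mulrC ler_wpM2l ?exprn_ge0 ?(ltW t0)//.
by rewrite truncn_le invr_ge0 exprn_ge0// ltW.
Qed.

(** The exponent [K] is at least [g^-n], so the value is at most [1 / (1 + K t^n) <= (g/t)^n]. *)
Lemma step_seq_cvg0 g t : 0 < g < t -> t < 1 -> step_seq g t @ \oo --> (0 : R).
Proof.
move=> /andP[g0 gt] t1; have t0 := lt_trans g0 gt.
have H : (g / t) ^+ n @[n --> \oo] --> (0 : R).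
  by apply: cvg_expr; rewrite ger0_norm ?divr_ge0 ?ltW// ltr_pdivrMr// mul1r.
apply: (@squeeze_cvgr _ _ _ _ (cst 0) _ _ _ _ _ H); last exact: cvg_cst.
apply: nearW => n.
have /andP[sn _] : 0 <= step_seq g t n <= 1 by apply: step_seq_ge0_le1; rewrite t0.
rewrite sn /=.
have tn : 0 <= t ^+ n <= 1 by rewrite exprn_ge0 ?exprn_ile1// ltW.
have := @bernoulli_le (t ^+ n) (Num.truncn (g ^- n)).+1 tn.
rewrite -/(step_seq g t n) /= => Hs.
have K0 : g ^- n <= (Num.truncn (g ^- n)).+1%:R by rewrite ltW// truncnS_gt.
have p0 : 0 < (g / t) ^+ n by rewrite exprn_gt0// divr_gt0.
rewrite -[leRHS]mul1r -ler_pdivrMr//; apply: le_trans Hs.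
rewrite ler_wpM2l// -[leLHS]add0r lerD// expr_div_n invf_div mulrC.
by rewrite ler_wpM2r// exprn_ge0// ltW.
Qed.

End StepApproximation.

Import HBNNSimple.

Section PolynomialDensity.
Variable R : realType.
Local Notation mu := (@lebesgue_measure R).
Variable w : R -> R.
Hypothesis mw : measurable_fun (@Lam R) w.
Hypothesis w_ge0 : forall x, Lam x -> 0 <= w x.
Hypothesis iw : mu.-integrable (@Lam R) (EFin \o w).
Implicit Types (f g h : R -> R) (p q r : {poly R}).

Let mL := @measurable_Lam R.

Definition poly_approx f := wL2 w f /\ forall e, 0 < e ->
  exists p : {poly R}, wdot w (fun x => f x - p.[x]) (fun x => f x - p.[x]) < e.

Lemma poly_approx_horner p : poly_approx (horner p).
Proof.
split; first exact: horner_wL2.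
move=> e e0; exists p; rewrite /wdot.
under eq_Rintegral do rewrite subrr !mul0r.
by rewrite Rintegral_cst// mul0r.
Qed.

(** The parallelogram law without its difference term. It replaces the triangle inequality, which is
    why errors are split below into quarters. *)
Lemma wdot_sqrD_le f g : wL2 w f -> wL2 w g ->
  wdot w (fun x => f x + g x) (fun x => f x + g x) <=
  2 * wdot w f f + 2 * wdot w g g.
Proof.
move=> Hf Hg; have := wdot_ge0 w_ge0 (fun x => f x - g x).
rewrite wdot_sqrB// wdotDl ?wdotDr//; last exact: wL2D.
by rewrite (wdotC w g f); lra.
Qed.

Lemma poly_approxD f g : poly_approx f -> poly_approx g ->
  poly_approx (fun x => f x + g x).
Proof.
move=> [Hf Af] [Hg Ag]; split; first exact: wL2D.
move=> e e0; have e4 : 0 < e / 4 by rewrite divr_gt0.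
have [p Hp] := Af _ e4; have [q Hq] := Ag _ e4; exists (p + q).
rewrite (eq_wdot w (f' := fun x => (f x - p.[x]) + (g x - q.[x]))
                   (g' := fun x => (f x - p.[x]) + (g x - q.[x]))); last 2 first.
- by move=> x; rewrite hornerD; ring.
- by move=> x; rewrite hornerD; ring.
apply: le_lt_trans (wdot_sqrD_le _ _) _; last by lra.
- by apply: wL2B => //; exact: horner_wL2.
- by apply: wL2B => //; exact: horner_wL2.
Qed.

Lemma poly_approxZ c f : poly_approx f -> poly_approx (fun x => c * f x).
Proof.
move=> [Hf Af]; split; first exact: wL2Z.
(* The denominator [c^2 + 1] stays positive when [c = 0]. *)
move=> e e0; have [p Hp] := Af (e / (c ^+ 2 + 1)) (divr_gt0 e0 (ltr_wpDl (sqr_ge0 c) ltr01)).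
exists (c *: p).
have Hfp : wL2 w (fun x => f x - p.[x]) by apply: wL2B => //; exact: horner_wL2.
rewrite (eq_wdot w (f' := fun x => c * (f x - p.[x]))
                   (g' := fun x => c * (f x - p.[x]))); last 2 first.
- by move=> x; rewrite hornerZ; ring.
- by move=> x; rewrite hornerZ; ring.
rewrite wdotZl// ?wdotZr//; last exact: wL2Z.
move: Hp; rewrite ltr_pdivlMr; last by rewrite ltr_wpDl ?sqr_ge0.
have := wdot_ge0 w_ge0 (fun x => f x - p.[x]).
by set D := wdot _ _ _; rewrite expr2; nra.
Qed.

(** Closure under dominated limits almost everywhere: this one lemma passes from polynomials to
    rays, from intervals to Borel sets, and from simple functions to all nonnegative ones. *)
Lemma poly_approx_lim (F : nat -> R -> R) f g :
  (forall n, poly_approx (F n)) -> measurable_fun (@Lam R) f -> wL2 w g ->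
  {ae mu, forall x, Lam x -> F ^~ x @ \oo --> f x} ->
  (forall n x, Lam x -> `|F n x| <= g x) -> (forall x, Lam x -> `|f x| <= g x) ->
  poly_approx f.
Proof.
move=> AF mf [mg ig] Ff Fg fg.
have Hf : wL2 w f.
  split => //; apply: (integrable_le _ _ ig) => //.
    by apply: measurable_funM => //; exact: measurable_funX.
  move=> x Lx; rewrite normrM (ger0_norm (w_ge0 Lx)) ler_wpM2r ?w_ge0//.
  by rewrite normrX lerXn2r// ?nnegrE ?fg// (le_trans _ (fg _ Lx)).
split => // e e0.
have : wdot w (fun x => f x - F n x) (fun x => f x - F n x) @[n --> \oo] --> (0 : R).
  have -> : (0 : R) = \int[mu]_(x in @Lam R) (0 : R) by rewrite Rintegral_cst// mul0r.
  (* Both [f] and [F n] are bounded by [g], so the squared difference is at most [(2 g)^2]. *)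
  apply: (@cvg_Rintegral _ _ _ _ (fun x => 4 * (g x ^+ 2 * w x))) => //.
  - move=> n; have [[mF _] _] := AF n.
    by apply: measurable_funM => //; apply: measurable_funM; exact: measurable_funB.
  - apply: ae_mono Ff => x + Lx => /(_ Lx) Ff.
    have H : f x - F n x @[n --> \oo] --> (0 : R).
      by rewrite -(subrr (f x)); apply: cvgB => //; exact: cvg_cst.
    have H0 : w x @[_ --> \oo] --> w x by exact: cvg_cst.
    by have := cvgM (cvgM H H) H0; rewrite !mul0r; apply.
  - exact: RintegrableZ.
  move=> n x Lx; rewrite !normrM (ger0_norm (w_ge0 Lx)) mulrA ler_wpM2r ?w_ge0//.
  have := Fg n _ Lx; have := fg _ Lx; have := ler_normB (f x) (F n x).
  have := normr_ge0 (f x - F n x).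
  by set A := `|_|; set B := `|_|; set C := `|F n x| => *; rewrite expr2; nra.
move=> /cvgrPdist_lt/(_ (e / 4)) []; first by rewrite divr_gt0.
move=> n _ /(_ n (leqnn n)) /=; rewrite sub0r normrN ger0_norm ?wdot_ge0// => Hn.
have [HFn /(_ (e / 4)) []] := AF n; first by rewrite divr_gt0.
move=> p Hp; exists p.
rewrite (eq_wdot w (f' := fun x => (f x - F n x) + (F n x - p.[x]))
                   (g' := fun x => (f x - F n x) + (F n x - p.[x]))); last 2 first.
- by move=> x; ring.
- by move=> x; ring.
apply: le_lt_trans (wdot_sqrD_le _ _) _; last by lra.
- exact: wL2B.
- by apply: wL2B => //; exact: horner_wL2.
Qed.

Lemma eq_poly_approx f g : (forall x, Lam x -> f x = g x) ->
  poly_approx f -> poly_approx g.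
Proof.
move=> fg [Hf Af]; have Hg : wL2 w g.
  have [mf if_] := Hf; split.
    by apply: eq_measurable_fun mf => x /set_mem /fg.
  by apply: eq_Rintegrable if_ => // x /fg ->.
split => // e /Af [p Hp]; exists p; rewrite (le_lt_trans _ Hp)//.
by rewrite /wdot le_eqVlt; apply/orP; left; apply/eqP;
  apply: eq_Rintegral => x /set_mem /fg ->.
Qed.

Lemma wL2_cst (c : R) : wL2 w (cst c).
Proof. by apply: (bounded_wL2 mw w_ge0 iw (M := `|c|)). Qed.

Lemma poly_approx_cst (c : R) : poly_approx (cst c).
Proof. by apply: eq_poly_approx (poly_approx_horner c%:P) => x _; rewrite hornerC. Qed.

(** In the variable [(1 + x) / 2], which maps [Lam] onto the open unit interval, [step_seq] is a
    polynomial; bounded pointwise convergence is enough, and no uniform approximation is used. *)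
Lemma poly_approx_ray (c : R) : poly_approx (\1_(`]-oo, c]) : R -> R).
Proof.
case: (leP c (-1)) => c1.
  apply: eq_poly_approx (poly_approx_cst 0) => x; rewrite /Lam/= in_itv/= => /andP[x1 _].
  by rewrite indicE mem_setE in_itv/= leNgt (le_lt_trans c1 x1).
case: (leP 1 c) => c2.
  apply: eq_poly_approx (poly_approx_cst 1) => x; rewrite /Lam/= in_itv/= => /andP[_ x1].
  by rewrite indicE mem_setE in_itv/= (le_trans (ltW x1) c2).
pose t x : R := (1 + x) / 2.
pose P n : {poly R} := (1 - (2^-1 *: (1 + 'X)) ^+ n) ^+ (Num.truncn ((t c) ^- n)).+1.
have PE n x : (P n).[x] = step_seq (t c) (t x) n.
  by rewrite /P /step_seq !hornerE /t mulrC.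
apply: (@poly_approx_lim (fun n => horner (P n)) _ (cst 1)).
- by move=> n; exact: poly_approx_horner.
- exact: measurable_indic.
- exact: wL2_cst.
(* The limit of [step_seq] is not controlled at the jump, but a single point is a null set. *)
- exists [set c]; split; first exact: measurable_set1.
    exact: lebesgue_measure_set1.
  move=> x /= /not_implyP [Lx H]; apply: contrapT => /eqP xc; apply: H.
  move: Lx; rewrite /Lam/= in_itv/= => /andP[x1 x2].
  rewrite indicE mem_setE in_itv/=; under eq_fun do rewrite PE.
  move: xc; rewrite neq_lt => /orP[xc|cx].
    by rewrite (ltW xc); apply: step_seq_cvg1; rewrite /t; lra.
  by rewrite leNgt cx; apply: step_seq_cvg0; rewrite /t; lra.
- move=> n x; rewrite /Lam/= in_itv/= => /andP[x1 x2]; rewrite PE.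
  have /andP[s0 s1] : 0 <= step_seq (t c) (t x) n <= 1.
    by apply: step_seq_ge0_le1; rewrite /t; lra.
  by rewrite ger0_norm.
- by move=> x Lx; rewrite indicE; case: (_ \in _); rewrite ?normr1 ?normr0.
Qed.

Lemma poly_approx_ocitv (A : set R) : ocitv A -> poly_approx (\1_A : R -> R).
Proof.
move=> /ocitvP [->|[[a b] /= ab ->]].
  by apply: eq_poly_approx (poly_approx_cst 0) => x _; rewrite indicE in_set0.
have := poly_approxD (poly_approx_ray b) (poly_approxZ (-1) (poly_approx_ray a)).
apply: eq_poly_approx => x _; rewrite !indicE !mem_setE !in_itv/=.
by case: (leP x a) => xa; case: (leP x b) => xb /=; lra.
Qed.

(** Half-open intervals form a generating pi-system, and the sets with approximable indicator form a
    Dynkin class: complements by linearity, disjoint unions by bounded convergence of partial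
    sums. *)
Lemma poly_approx_indic (A : set (measurableTypeR R)) :
  measurable A -> poly_approx (\1_A : R -> R).
Proof.
move=> mA; apply: (@dynkin_induction _ (measurableTypeR R) (@ocitv R)
  (fun A => poly_approx (\1_A : R -> R))) => //.
- exact: ocitvI.
- by apply: eq_poly_approx (poly_approx_cst 1) => x _; rewrite indicE in_setT.
- exact: poly_approx_ocitv.
- move=> S _ HS; have := poly_approxD (poly_approx_cst 1) (poly_approxZ (-1) HS).
  by apply: eq_poly_approx => x _; rewrite !indicE in_setC /=; case: (_ \in _); rewrite /=; lra.
move=> F mF tF HF.
apply: (@poly_approx_lim (fun n x => \sum_(i < n) \1_(F i) x) _ (cst 1)).
- elim=> [|n IH].
    by apply: eq_poly_approx (poly_approx_cst 0) => x _; rewrite big_ord0.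
  apply: eq_poly_approx (poly_approxD IH (HF n)) => x _.
  by rewrite big_ord_recr.
- by apply: measurable_indic; apply: bigcup_measurable => k _; exact: mF.
- exact: wL2_cst.
- apply: aeW => x Lx; case: (pselect ((\bigcup_k F k) x)) => [Ux|nUx].
    have [k _ Fkx] := Ux; rewrite indicE (mem_set Ux).
    apply: cvg_near_cst; near=> n; apply/eqP.
    have kn : (k < n)%N by near: n; exact: nbhs_infty_gt.
    rewrite (bigD1 (Ordinal kn))//= big1 ?addr0 ?indicE ?mem_set// => i ik.
    rewrite indicE memNset// => Fix_; move/eqP: ik; apply; apply/val_inj => /=.
    by apply: tF => //; exists x.
  rewrite indicE memNset//; apply: cvg_near_cst; apply: nearW => n.
  rewrite big1// => i _; rewrite indicE memNset// => Fix_; apply: nUx.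
  by exists (i : nat).
- move=> n x Lx; rewrite ger0_norm; last by apply: sumr_ge0 => i _; rewrite indicE.
  case: (pselect (exists i : 'I_n, F i x)) => [[i Fix_]|nF].
    rewrite (bigD1 i)//= big1 ?addr0 ?indicE ?mem_set// => j ji.
    rewrite indicE memNset// => Fjx; move/eqP: ji; apply; apply/val_inj => /=.
    by apply: tF => //; exists x.
  rewrite big1// => i _; rewrite indicE memNset// => Fix_; apply: nF.
  by exists i.
- by move=> x Lx; rewrite indicE; case: (_ \in _); rewrite ?normr1 ?normr0.
Unshelve. all: by end_near. Qed.

(** The simple functions approach [f] from below, so [f] is its own dominating function. *)
Lemma poly_approx_ge0 f : wL2 w f -> (forall x, Lam x -> 0 <= f x) -> poly_approx f.
Proof.
move=> Hf f0; have [mf _] := Hf.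
have mf' : measurable_fun (@Lam R : set (measurableTypeR R)) (EFin \o f).
  exact/measurable_EFinP.
have f0' x : Lam x -> (0 <= (EFin \o f) x)%E by move=> /f0; rewrite lee_fin.
pose F := nnsfun_approx mL mf'.
have Ff n (x : measurableTypeR R) : Lam x -> F n x <= f x.
  by move=> Lx; rewrite /F nnsfun_approxE -lee_fin; exact: (le_approx n f0' Lx).
apply: (@poly_approx_lim (fun n => F n) f f) => //.
- move=> n; have FE (x : measurableTypeR R) :
    F n x = \sum_(y <- fset_set (range (F n))) (y * \1_(F n @^-1` [set y]) x).
    by rewrite fimfunE fsbig_finite.
  apply: (@eq_poly_approx (fun x => \sum_(y <- fset_set (range (F n)))
    (y * \1_(F n @^-1` [set y]) x))) => [x _|]; first by rewrite FE.
  elim: (enum_fset (fset_set (range (F n)))) => [|y s IH].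
    by apply: eq_poly_approx (poly_approx_cst 0) => x _; rewrite big_nil.
  have mA : measurable (F n @^-1` [set y]).
    exact: measurable_funPTI.
  apply: eq_poly_approx (poly_approxD (poly_approxZ y (poly_approx_indic mA)) IH) => x _.
  by rewrite big_cons.
- apply: aeW => x Lx.
  have := cvg_nnsfun_approx mL mf' f0' Lx.
  by move=> /fine_cvg.
- by move=> n x Lx; rewrite ger0_norm// Ff.
- by move=> x Lx; rewrite ger0_norm ?f0.
Qed.

Theorem poly_dense f : wL2 w f -> poly_approx f.
Proof.
move=> Hf; have [mf if_] := Hf.
have H g : measurable_fun (@Lam R) g -> (forall x, `|g x| <= `|f x|) -> wL2 w g.
  move=> mg gf; split => //; apply: (integrable_le _ _ if_) => //.
    by apply: measurable_funM => //; exact: measurable_funX.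
  move=> x Lx; rewrite normrM (ger0_norm (w_ge0 Lx)) ler_wpM2r ?w_ge0//.
  by rewrite normrX -(real_normK (num_real (f x))) lerXn2r// ?nnegrE.
have Hp : poly_approx (fun x => Num.max (f x) 0).
  apply: poly_approx_ge0 => [|x _]; last by rewrite le_max lexx orbT.
  apply: H => [|x]; first exact: measurable_maxr.
  by case: (leP (f x) 0); rewrite ?normr0.
have Hn : poly_approx (fun x => Num.max (- f x) 0).
  apply: poly_approx_ge0 => [|x _]; last by rewrite le_max lexx orbT.
  apply: H => [|x].
    by apply: measurable_maxr => //; exact: measurableT_comp.
  by case: (leP (- f x) 0); rewrite ?normr0// normrN.
apply: eq_poly_approx (poly_approxD Hp (poly_approxZ (-1) Hn)) => x _.
by case: (leP (f x) 0) => ?; case: (leP (- f x) 0) => ?; lra.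
Qed.

End PolynomialDensity.

(** * Weak derivatives and the Jacobi weight *)

Section LocallyIntegrable.
Variable R : realType.
Local Notation mu := (@lebesgue_measure R).
Implicit Types (h phi : R -> R) (c d : R).

Let mL := @measurable_Lam R.

Lemma itv_cc_subset_Lam c d : -1 < c -> d < 1 -> `[c, d] `<=` @Lam R.
Proof.
move=> c1 d1 x; rewrite /Lam/= !in_itv/= => /andP[cx xd].
by rewrite (lt_le_trans c1 cx) (le_lt_trans xd d1).
Qed.

Lemma locally_integrable_itv h c d : locally_integrable (@Lam R) h ->
  -1 < c -> d < 1 -> mu.-integrable `[c, d] (EFin \o h).
Proof.
move=> [mh _ Hh] c1 d1; have sub := itv_cc_subset_Lam c1 d1.
apply/integrableP; split.
  by apply/measurable_EFinP; apply: measurable_funS mh => //; exact: measurable_Lam.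
by apply: Hh => //; exact: segment_compact.
Qed.

Lemma integrable_norm_indic h c d : locally_integrable (@Lam R) h ->
  -1 < c -> d < 1 ->
  mu.-integrable (@Lam R) (EFin \o (fun x => `|h x| * \1_(`[c, d]) x)).
Proof.
move=> Hh c1 d1; have sub := itv_cc_subset_Lam c1 d1.
have ih := integrable_norm (locally_integrable_itv Hh c1 d1).
have mI : measurable (`[c, d] : set (measurableTypeR R)) by exact: measurable_itv.
have : mu.-integrable (@Lam R `&` `[c, d]) (EFin \o (fun x => `|h x|)).
  by rewrite (setIidr sub).
move=> /(integrable_restrict _ mI mL).
apply: eq_integrable => // x _; rewrite /= patchE indicE /=.
by case: ifPn => _; rewrite ?mulr1 ?mulr0.
Qed.

Lemma integrable_test_fun h phi : locally_integrable (@Lam R) h ->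
  test_fun phi -> mu.-integrable (@Lam R) (EFin \o (fun x => h x * phi x)).
Proof.
move=> Hh tphi; have [M phiM] := test_fun_bounded tphi.
have cphi := test_fun_continuous tphi.
have [_ [c /andP[c0 c1] phi0]] := tphi; have [mh _ _] := Hh.
have cN : -1 < - c by rewrite ltrN2.
have iM := RintegrableZ M mL (integrable_norm_indic Hh cN c1).
apply: (integrable_le mL _ iM) => //.
  by apply: measurable_funM => //; exact: measurable_fun_Lam.
move=> x Lx; rewrite normrM indicE mem_setE in_itv/= -ler_norml.
case: (leP `|x| c) => cx; last by rewrite phi0// normr0 !mulr0.
by rewrite mulr1 mulrC ler_wpM2r.
Qed.

(** The cutoffs are test functions and tend boundedly to the indicator of the interval. *)
Lemma Rintegral_itv_test_fun h :
  locally_integrable (@Lam R) h ->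
  (forall phi, test_fun phi -> \int[mu]_(x in @Lam R) (h x * phi x) = 0) ->
  forall c d, -1 < c -> d < 1 -> \int[mu]_(x in `]c, d[) h x = 0.
Proof.
move=> Hh H0 c d c1 d1; have [mh _ _] := Hh.
have sub : `]c, d[ `<=` @Lam R.
  by apply: subset_trans (itv_cc_subset_Lam c1 d1); exact: subset_itv_oo_cc.
have E : \int[mu]_(x in `]c, d[) h x = \int[mu]_(x in @Lam R) (h x * \1_(`]c, d[) x).
  rewrite -(setIidr sub) Rintegral_mkcondr; apply: eq_Rintegral => x _.
  by rewrite patch_indic /= (setIidr sub).
have mcut k : measurable_fun (@Lam R) (cutoff c d k).
  apply: measurable_fun_Lam => x; apply: differentiable_continuous.
  by apply/derivable1_diffP; have [+ _] := diff_on_cutoff 1 c d k; apply.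
have : \int[mu]_(x in @Lam R) (h x * cutoff c d k x) @[k --> \oo] -->
    \int[mu]_(x in @Lam R) (h x * \1_(`]c, d[) x).
  apply: (cvg_Rintegral (g := fun x => `|h x| * \1_(`[c, d]) x)) => //.
  - by move=> k; apply: measurable_funM => //; exact: mcut.
  - by apply: measurable_funM => //; exact: measurable_indic.
  - by apply: aeW => x _; apply: cvgM; [exact: cvg_cst|exact: cutoff_cvg_indic].
  - exact: integrable_norm_indic.
  move=> k x Lx; rewrite normrM ler_wpM2l// ger0_norm ?cutoff_ge0// indicE mem_setE in_itv/=.
  case: (boolP (c <= x <= d)) => [_|]; first exact: cutoff_le1.
  by rewrite negb_and -!ltNge => /orP[] /ltW ?; rewrite cutoff_out//; [left|right].
rewrite -E => /cvg_lim <- //.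
have -> : (fun k => \int[mu]_(x in @Lam R) (h x * cutoff c d k x)) = cst 0.
  apply/funext => k; apply: H0.
  have := @test_fun_cutoff R (cst 1) c d k (ltW c1) (ltW d1) (fun n => diff_on_cst _ n 1).
  by under eq_fun do rewrite mul1r.
exact: lim_cst.
Qed.

(** The fundamental lemma of the calculus of variations. For [h] cut off to [[-r, r]] the primitive
    vanishes identically, and by Lebesgue differentiation its derivative is [h] almost everywhere
    there; countably many [r] exhaust the interval. *)
Lemma locally_integrable_ae0 h :
  locally_integrable (@Lam R) h ->
  (forall phi, test_fun phi -> \int[mu]_(x in @Lam R) (h x * phi x) = 0) ->
  {ae mu, forall x, Lam x -> h x = 0}.
Proof.
move=> Hh H0; have I0 := Rintegral_itv_test_fun Hh H0.
have Hr (r : R) : r < 1 -> {ae mu, forall x, `[- r, r]%classic x -> h x = 0}.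
  move=> r1; have rN : -1 < - r by rewrite ltrN2.
  have ih := locally_integrable_itv Hh rN r1.
  have mI : measurable (`[- r, r] : set (measurableTypeR R)) by exact: measurable_itv.
  pose f := h \_ `[- r, r].
  have if_ : mu.-integrable setT (EFin \o f).
    by rewrite /f -restrict_EFin; exact/(integrable_mkcond _ mI).
  have lf : locally_integrable setT f by apply: integrable_locally.
  have ify y : mu.-integrable `]-oo, y] (EFin \o f).
    by apply: integrableS if_ => //; exact: measurable_itv.
  have /= := FTC1Ny ify lf.
  have F0 y : \int[mu]_(t in `]-oo, y]) f t = 0.
    rewrite /f -Rintegral_mkcondr.
    have J0 z : - r <= z -> z <= r -> \int[mu]_(x in `[- r, z]) h x = 0.
      move=> rz zr; have iz := locally_integrable_itv Hh rN (le_lt_trans zr r1).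
      rewrite -Rintegral_itv_bndo_bndc; last first.
        by apply: integrableS iz => // x /=; rewrite !in_itv/= => ?; lra.
      rewrite -Rintegral_itv_obnd_cbnd; last first.
        by apply: integrableS iz => // x /=; rewrite !in_itv/= => ?; lra.
      by rewrite I0// (le_lt_trans zr).
    case: (ltP y (- r)) => yr.
      have -> : `]-oo, y] `&` `[- r, r] = set0.
        by apply/seteqP; split => // x /=; rewrite !in_itv/= => -[xy /andP[rx _]]; lra.
      by rewrite Rintegral_set0.
    have [ry|ry] := leP r y.
      have -> : `]-oo, y] `&` `[- r, r] = `[- r, r]%classic.
        apply/seteqP; split => [x /= []//|x /=]; rewrite !in_itv/= => /[dup] /andP[_ xr] ->.
        by rewrite (le_trans xr ry).
      by case: (leP (- r) r) => rr; [exact: J0|rewrite set_itv_ge ?Rintegral_set0// bnd_simp -ltNge].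
    have -> : `]-oo, y] `&` `[- r, r] = `[- r, y]%classic.
      apply/seteqP; split => [x /= []|x /=]; rewrite !in_itv/=.
        by move=> -> /andP[->].
      by move=> /andP[-> xy]; rewrite xy (le_trans xy (ltW ry)).
    by apply: J0 => //; exact: ltW.
  apply: ae_mono => x /= [_].
  have -> : (fun x0 : R => \int[mu]_(t in `]-oo, x0]) f t) = cst 0 by exact/funext.
  by rewrite derive1_cst /f patchE => + xr; rewrite mem_set// => <-.
have := @ae_foralln _ _ R mu (fun n x => `[- (1 - n.+1%:R^-1), 1 - n.+1%:R^-1]%classic x -> h x = 0)
  (fun n => Hr (1 - n.+1%:R^-1) _).
move=> H; apply: ae_mono (H _) => [x Hx Lx|n]; last by rewrite ltrBlDr ltrDl invr_gt0.
have : 0 < 1 - `|x|.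
  by move: Lx; rewrite /Lam/= in_itv/= subr_gt0 -ltr_norml.
move=> e0; have [n] := ltr_add_invr e0.
rewrite add0r => Hn; apply: (Hx n); rewrite /= in_itv/= -ler_norml.
by rewrite lerBrDr addrC -lerBrDr ltW.
Qed.

End LocallyIntegrable.

(** * The Jacobi weight: integrability, derivatives, and cutoffs near the endpoints *)

Section JacobiWeight.
Variable R : realType.
Local Notation mu := (@lebesgue_measure R).
Implicit Types (a b p x : R) (r : {poly R}).

Let mL := @measurable_Lam R.

Lemma LamE x : @Lam R x = (-1 < x < 1).
Proof. by rewrite /Lam/= in_itv. Qed.

Lemma is_derive_powR_onem p x : x < 1 ->
  is_derive x 1 (fun x => (1 - x) `^ p) (- (p * (1 - x) `^ (p - 1))).
Proof.
move=> x1; have x0 : 0 < 1 - x by rewrite subr_gt0.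
have d1 : is_derive x 1 (fun x : R => 1 - x) (-1).
  have := is_derive_affine (-1) 1 x.
  by rewrite (_ : (fun x => _) = (fun x => 1 - x))//; apply/funext => y; ring.
have := @is_derive1_comp _ (fun y => y `^ p) _ x _ _ (is_derive1_powR p x0) d1.
by rewrite mulrN1.
Qed.

Lemma is_derive_powR_1D p x : -1 < x ->
  is_derive x 1 (fun x => (1 + x) `^ p) (p * (1 + x) `^ (p - 1)).
Proof.
move=> x1; have x0 : 0 < 1 + x by lra.
have d1 : is_derive x 1 (fun x : R => 1 + x) 1.
  have := is_derive_affine 1 1 x.
  by rewrite (_ : (fun x => _) = (fun x => 1 + x))//; apply/funext => y; ring.
have := @is_derive1_comp _ (fun y => y `^ p) _ x _ _ (is_derive1_powR p x0) d1.
by rewrite mulr1.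
Qed.

Lemma measurable_powR_onem p D : measurable_fun D (fun x : R => (1 - x) `^ p).
Proof.
apply: measurable_funTS; apply: (measurableT_comp (measurable_powR p)).
by apply: measurable_funB.
Qed.

Lemma measurable_powR_1D p D : measurable_fun D (fun x : R => (1 + x) `^ p).
Proof.
apply: measurable_funTS; apply: (measurableT_comp (measurable_powR p)).
by apply: measurable_funD.
Qed.

Lemma measurable_jweight a b D : measurable_fun D (@jweight R a b).
Proof.
by apply: measurable_funM; [exact: measurable_powR_onem|exact: measurable_powR_1D].
Qed.

Lemma jweight_ge0 a b x : 0 <= jweight a b x.
Proof. by rewrite mulr_ge0 ?powR_ge0. Qed.

(** For [a < 0] the integrand is singular at [1], hence intervals that stop short of it. The
    primitive is [- (1 - x)^(a+1) / (a+1)]; dropping its nonpositive value at the right end leaves a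
    bound independent of [n]. *)
Lemma integral_powR_onem_le a n : -1 < a ->
  (\int[mu]_(x in `[(-1)%R, (1 - n.+1%:R^-1)%R]) ((1 - x)%R `^ a)%R%:E <=
   (2 `^ (a + 1) / (a + 1))%R%:E)%E.
Proof.
move=> a1; set c : R := 1 - _.
have c1 : c < 1 by rewrite /c ltrBlDr ltrDl invr_gt0.
have cN : -1 < c.
  have : n.+1%:R^-1 <= 1 :> R by rewrite invf_le1 ?ler1n.
  by rewrite /c; set z := _^-1 => ?; lra.
pose F x := - (a + 1)^-1 * (1 - x) `^ (a + 1).
have a10 : 0 < a + 1 by lra.
have dF x : x < 1 -> is_derive x 1 F ((1 - x) `^ a).
  move=> x1; have := is_deriveZ (- (a + 1)^-1) (is_derive_powR_onem (a + 1) x1).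
  rewrite addrK (_ : _ *: _ = (1 - x) `^ a)//.
  by rewrite /GRing.scale/= mulrNN mulKf// gt_eqF.
have dp x : x < 1 -> {for x, continuous (fun x : R => (1 - x) `^ a)}.
  move=> x1; apply: differentiable_continuous; apply/derivable1_diffP.
  by have [] := is_derive_powR_onem a x1.
have cF x : x < 1 -> {for x, continuous F}.
  move=> x1; apply: differentiable_continuous; apply/derivable1_diffP.
  by have [] := dF _ x1.
rewrite (@continuous_FTC2 _ _ F)//.
- rewrite -EFinB lee_fin /F (_ : 1 - -1 = 2 :> R); last by lra.
  have : 0 <= (a + 1)^-1 * (1 - c) `^ (a + 1).
    by rewrite mulr_ge0 ?powR_ge0// invr_ge0 ltW.
  by lra.
- apply: continuous_in_subspaceT => x; rewrite mem_setE in_itv/= => /andP[_ xc].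
  by apply: dp; exact: le_lt_trans c1.
- split.
  + by move=> x; rewrite in_itv/= => /andP[_ xc]; have [] := dF _ (lt_trans xc c1).
  + by apply: cvg_at_right_filter; apply: cF; lra.
  + by apply: cvg_at_left_filter; apply: cF.
- move=> x; rewrite in_itv/= => /andP[_ xc].
  by rewrite derive1E; have [_ ->] := dF _ (lt_trans xc c1).
Qed.

Lemma integrable_powR_onem a : -1 < a ->
  mu.-integrable (@Lam R) (EFin \o (fun x => (1 - x) `^ a)).
Proof.
move=> a1; apply/integrableP; split.
  by apply/measurable_EFinP; exact: measurable_powR_onem.
pose F n : set (measurableTypeR R) := `[-1, 1 - n.+1%:R^-1]%classic.
have mF n : measurable (F n) by exact: measurable_itv.
have := @ge0_nondecreasing_set_cvg_integral _ (measurableTypeR R) R F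
  (fun x => ((1 - x) `^ a)%:E) mu _ mF _ _.
set l := (X in _ --> X).
have ndF : nondecreasing_seq F.
  move=> i j ij; apply/subsetPset => x; rewrite /F/= !in_itv/= => /andP[-> xi].
  by rewrite (le_trans xi)// lerB// lef_pV2 ?posrE// ler_nat.
have mf i : measurable_fun (F i) (fun x => ((1 - x) `^ a)%:E).
  by apply/measurable_EFinP; exact: measurable_powR_onem.
move=> /(_ ndF mf) Hl0.
have Hl := Hl0 (fun i x _ => powR_ge0 (1 - x) a).
have ll : (l <= (2 `^ (a + 1) / (a + 1))%:E)%E.
  by apply: cvge_le Hl; apply: nearW => n; exact: integral_powR_onem_le.
apply: (@le_lt_trans _ _ l); last exact: (le_lt_trans ll (ltry _)).
under eq_integral do rewrite gee0_abs ?lee_fin ?powR_ge0//.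
apply: ge0_subset_integral => //.
- exact: bigcup_measurable.
- by apply/measurable_EFinP; exact: measurable_powR_onem.
- by move=> x _; rewrite lee_fin powR_ge0.
move=> x; rewrite LamE => /andP[x0 x1].
have /ltr_add_invr [n] : 0 < 1 - x by rewrite subr_gt0.
rewrite add0r => Hn; exists n => //; rewrite /F/= in_itv/= (ltW x0)/=.
by rewrite lerBrDr addrC -lerBrDr ltW.
Qed.

Lemma integrable_jweight a b : -1 < a -> 0 <= b ->
  mu.-integrable (@Lam R) (EFin \o @jweight R a b).
Proof.
move=> a1 b0; have ig := RintegrableZ (2 `^ b) mL (integrable_powR_onem a1).
apply: (integrable_le mL _ ig); first exact: measurable_jweight.
move=> x; rewrite LamE => /andP[x0 x1].
rewrite ger0_norm ?jweight_ge0// /jweight mulrC ler_wpM2r ?powR_ge0//.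
by rewrite ge0_ler_powR ?nnegrE//; lra.
Qed.

Lemma jweightS a b x : Lam x ->
  jweight (a + 1) (b + 1) x = jweight a b x * ((1 - x) * (1 + x)).
Proof.
rewrite LamE => /andP[x0 x1]; have p1 : 0 < 1 - x by lra.
have p2 : 0 < 1 + x by lra.
rewrite /jweight !powRD ?(gt_eqF p1) ?(gt_eqF p2) ?implybT//.
by rewrite !powRr1 ?(ltW p1) ?(ltW p2)//; ring.
Qed.

Lemma diff_on_jweight n a b : diff_on (@Lam R) n (jweight a b).
Proof.
have oL : open (@Lam R) by exact: interval_open.
have o0 : open (`]0, +oo[%classic : set R) by exact: interval_open.
have H c d p : (forall x, Lam x -> 0 < c * x + d) ->
    diff_on (@Lam R) n (fun x => (c * x + d) `^ p).
  move=> pos; apply: diff_on_subset (diff_on_affine c d o0 (diff_on_powR n p)).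
  by move=> x /pos; rewrite /= in_itv/= andbT.
have := diff_onM oL (H (-1) 1 a _) (H 1 1 b _).
move=> HH; apply: eq_diff_on (HH _ _) => //.
- by move=> x _; rewrite /jweight; congr (_ `^ _ * _ `^ _); ring.
- by move=> x; rewrite LamE; lra.
- by move=> x; rewrite LamE; lra.
Qed.

(** With [w] the weight of exponents [a], [b], this is [w^-1 ((1-x^2) w r)']: up to sign, the formal
    adjoint of differentiation between the weights [(a, b)] and [(a+1, b+1)]. *)
Definition jop a b r : {poly R} :=
  r^`() * (1 - 'X) * (1 + 'X) + r * ((b + 1) *: (1 - 'X) - (a + 1) *: (1 + 'X)).

Lemma is_derive_jop a b r x : Lam x ->
  is_derive x 1 (fun x => r.[x] * jweight (a + 1) (b + 1) x)
    ((jop a b r).[x] * jweight a b x).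
Proof.
move=> Lx; have := Lx; rewrite LamE => /andP[x0 x1].
have D := is_deriveM (is_derive_poly r x) (is_deriveM (is_derive_powR_onem (a + 1) x1)
  (is_derive_powR_1D (b + 1) x0)).
apply: is_derive_eq D _.
have p1 : 0 < 1 - x by lra.
have p2 : 0 < 1 + x by lra.
have pA : (1 - x) `^ (a + 1) = (1 - x) `^ a * (1 - x).
  by rewrite powRD ?(gt_eqF p1) ?implybT// powRr1 ?(ltW p1).
have pB : (1 + x) `^ (b + 1) = (1 + x) `^ b * (1 + x).
  by rewrite powRD ?(gt_eqF p2) ?implybT// powRr1 ?(ltW p2).
rewrite !addrK /jop !hornerE /jweight.
transitivity (r.[x] * ((1 - x) `^ (a + 1) * ((b + 1) * (1 + x) `^ b) +
   (1 + x) `^ (b + 1) * - ((a + 1) * (1 - x) `^ a)) +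
   (1 - x) `^ (a + 1) * (1 + x) `^ (b + 1) * r^`().[x]) => //.
rewrite pA pB; transitivity ((r^`().[x] * (1 - x) * (1 + x) +
  r.[x] * ((b + 1) * (1 - x) - (a + 1) * (1 + x))) * ((1 - x) `^ a * (1 + x) `^ b)); first by ring.
exact: mulrA.
Qed.

Definition cutoff_deriv k x : R :=
  k%:R * flat_exp 2 (k%:R * (1 + x) - 1) * flat_exp 0 (k%:R * (1 - x) - 1)
  - flat_exp 0 (k%:R * (1 + x) - 1) * (k%:R * flat_exp 2 (k%:R * (1 - x) - 1)).

(* The commutator term [(1 - x^2) chi_k'] is bounded uniformly in [k] and tends to
   [0]: this is what kills the boundary terms in the integration by parts. *)
Lemma cutoff_deriv_bound k x : Lam x ->
  `|(1 - x) * (1 + x) * cutoff_deriv k x| <= 12.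
Proof.
rewrite LamE => /andP[x0 x1].
have G y : 0 <= k%:R * y * flat_exp 2 (k%:R * y - 1) <= (3 : R).
  have := flat_exp_deriv_le (k%:R * y - 1); have := flat_exp_deriv_ge0 (k%:R * y - 1).
  by rewrite subrK => -> ->.
have F y : 0 <= flat_exp 0 y <= (1 : R) by rewrite flat_exp_ge0 flat_exp_le.
have -> : (1 - x) * (1 + x) * cutoff_deriv k x =
    (1 - x) * (k%:R * (1 + x) * flat_exp 2 (k%:R * (1 + x) - 1) * flat_exp 0 (k%:R * (1 - x) - 1)) -
    (1 + x) * (k%:R * (1 - x) * flat_exp 2 (k%:R * (1 - x) - 1) * flat_exp 0 (k%:R * (1 + x) - 1)).
  by rewrite /cutoff_deriv; ring.
have H c u v : 0 <= c <= 2 -> 0 <= u <= 3 -> 0 <= v <= 1 -> 0 <= c * (u * v) <= (6 : R).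
  move=> /andP[c0 c2] /andP[u0 u3] /andP[v0 v1].
  rewrite !mulr_ge0//= (_ : 6 = 2 * (3 * 1)); last by ring.
  by rewrite ler_pM ?mulr_ge0// ler_pM.
have cm : 0 <= 1 - x <= 2 by lra.
have cp : 0 <= 1 + x <= 2 by lra.
have := H _ _ _ cm (G (1 + x)) (F (k%:R * (1 - x) - 1)).
have := H _ _ _ cp (G (1 - x)) (F (k%:R * (1 + x) - 1)).
set A := (1 - x) * _; set B := (1 + x) * _ => /andP[B0 B6] /andP[A0 A6].
by rewrite ler_norml; lra.
Qed.

Lemma cutoff_deriv_cvg0 x : Lam x ->
  (1 - x) * (1 + x) * cutoff_deriv k x @[k --> \oo] --> (0 : R).
Proof.
rewrite LamE => /andP[x0 x1].
have p1 : 0 < 1 - x by lra.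
have p2 : 0 < 1 + x by lra.
have c1 : (fun _ : nat => 1 - x) @ \oo --> 1 - x by exact: cvg_cst.
have c2 : (fun _ : nat => 1 + x) @ \oo --> 1 + x by exact: cvg_cst.
have H := cvgB
  (cvgM c1 (cvgM (flat_exp_deriv_cvg0 p2) (flat_exp_cvg1 p1)))
  (cvgM c2 (cvgM (flat_exp_deriv_cvg0 p1) (flat_exp_cvg1 p2))).
rewrite !mul0r !mulr0 subrr in H.
rewrite (_ : (fun k => _) = (fun k : nat =>
    (1 - x) * (k%:R * (1 + x) * flat_exp 2 (k%:R * (1 + x) - 1) * flat_exp 0 (k%:R * (1 - x) - 1)) -
    (1 + x) * (k%:R * (1 - x) * flat_exp 2 (k%:R * (1 - x) - 1) * flat_exp 0 (k%:R * (1 + x) - 1)))).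
  exact: H.
by apply/funext => k; rewrite /cutoff_deriv; ring.
Qed.

End JacobiWeight.

Section WeakDerivatives.
Variable R : realType.
Local Notation mu := (@lebesgue_measure R).
Implicit Types (f g : R -> R).

Let mL := @measurable_Lam R.

Lemma is_weak_derivB j f g f' g' : is_weak_deriv j f g -> is_weak_deriv j f' g' ->
  is_weak_deriv j (fun x => f x - f' x) (fun x => g x - g' x).
Proof.
move=> [lf lg H] [lf' lg' H']; split; [exact: locally_integrableB..|].
move=> phi tphi; have tphij := derive1n_test_fun j tphi.
under eq_Rintegral do rewrite mulrBl.
rewrite RintegralB//; [|exact: integrable_test_fun..].
under [in RHS]eq_Rintegral do rewrite mulrBl.
rewrite RintegralB//; [|exact: integrable_test_fun..].
by rewrite H// H'// mulrBr.
Qed.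

Lemma locally_integrable_horner (p : {poly R}) : locally_integrable (@Lam R) (horner p).
Proof.
have oL : open (@Lam R) by exact: interval_open.
split => //; first by apply: measurable_fun_Lam; exact: continuous_horner.
move=> K KL cK; have : mu.-integrable K (EFin \o horner p).
  apply: continuous_compact_integrable => //.
  by apply: continuous_subspaceT; exact: continuous_horner.
by move=> /integrableP[].
Qed.

Lemma Rintegral_Lam_cc f : mu.-integrable `[(-1), 1] (EFin \o f) ->
  \int[mu]_(x in @Lam R) f x = \int[mu]_(x in `[(-1), 1]) f x.
Proof.
move=> if_; rewrite -Rintegral_itv_obnd_cbnd; last first.
  by apply: integrableS if_ => // x /=; rewrite !in_itv/= => ?; lra.
rewrite -Rintegral_itv_bndo_bndc//.
by apply: integrableS if_ => // x /=; rewrite !in_itv/= => ?; lra.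
Qed.

Lemma is_weak_deriv_horner (p : {poly R}) :
  is_weak_deriv 1 (horner p) (horner p^`()).
Proof.
split; [exact: locally_integrable_horner..|].
move=> phi tphi; rewrite derive1n1 expr1 mulN1r.
have tphi' := derive1_test_fun tphi.
have cphi := test_fun_continuous tphi; have cphi' := test_fun_continuous tphi'.
have [dphi [c /andP[c0 c1] phi0]] := tphi.
have ii f : continuous f -> mu.-integrable `[(-1), 1] (EFin \o f).
  move=> cf; apply: continuous_compact_integrable; first exact: segment_compact.
  exact: continuous_subspaceT.
rewrite !Rintegral_Lam_cc; last 2 first.
- by apply: ii => x; apply: cvgM; [exact: continuous_horner|exact: cphi].
- by apply: ii => x; apply: cvgM; [exact: continuous_horner|exact: cphi'].
rewrite (@Rintegration_by_parts _ (horner p) phi (horner p^`())).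
- by rewrite !phi0 ?normrN ?normr1// !mulr0 subrr sub0r.
- by lra.
- by apply: continuous_subspaceT; exact: continuous_horner.
- split; first by move=> x _; exact: derivable_horner.
  + by apply: cvg_at_right_filter; exact: continuous_horner.
  + by apply: cvg_at_left_filter; exact: continuous_horner.
- by move=> x _; rewrite derivE.
- exact: continuous_subspaceT.
- split; first by move=> x _; exact: (dphi 0%N).
  + by apply: cvg_at_right_filter; exact: cphi.
  + by apply: cvg_at_left_filter; exact: cphi.
- by [].
Qed.

End WeakDerivatives.

(** * Integration by parts against weighted polynomials *)

Section SturmLiouville.
Variable R : realType.
Local Notation mu := (@lebesgue_measure R).
Variables a b : R.
Hypotheses (a_gt : -1 < a) (b_ge0 : 0 <= b).
Implicit Types (f g : R -> R) (p q r : {poly R}).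

Let mL := @measurable_Lam R.
Let w0 := @jweight R a b.
Let w1 := @jweight R (a + 1) (b + 1).
Let a1_gt : -1 < a + 1. Proof. by rewrite (lt_trans a_gt)// ltrDl. Qed.
Let b1_ge0 : 0 <= b + 1. Proof. by rewrite addr_ge0. Qed.
Let mw0 : measurable_fun (@Lam R) w0. Proof. exact: measurable_jweight. Qed.
Let mw1 : measurable_fun (@Lam R) w1. Proof. exact: measurable_jweight. Qed.
Let w0_ge0 (x : R) (_ : Lam x) : 0 <= w0 x. Proof. exact: jweight_ge0. Qed.
Let w1_ge0 (x : R) (_ : Lam x) : 0 <= w1 x. Proof. exact: jweight_ge0. Qed.
Let iw0 := integrable_jweight a_gt b_ge0.
Let iw1 := integrable_jweight a1_gt b1_ge0.
Let pw0 := horner_wL2 mw0 w0_ge0 iw0.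
Let pw1 := horner_wL2 mw1 w1_ge0 iw1.

(** The weak derivative is tested against [r w1] times a cutoff, and the cutoff is then removed on
    both sides by dominated convergence; the dominating functions come from membership in the two
    weighted spaces. *)
Lemma weak_deriv_ibp f g r : wL2 w0 f -> wL2 w1 g -> is_weak_deriv 1 f g ->
  wdot w1 g (horner r) = - wdot w0 f (horner (jop a b r)).
Proof.
move=> Hf Hg [_ _ H]; have [mf _] := Hf; have [mg _] := Hg.
pose rho x := r.[x] * w1 x.
pose phi k x := rho x * cutoff (-1) 1 k x.
have tphi k : test_fun (phi k).
  apply: test_fun_cutoff => // n; apply: diff_onM; first exact: interval_open.
    exact: diff_on_horner.
  exact: diff_on_jweight.
have phi'E k x : Lam x -> ((phi k)^`())%classic x =
    rho x * cutoff_deriv k x + cutoff (-1) 1 k x * ((jop a b r).[x] * w0 x).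
  move=> Lx; rewrite derive1E.
  by have [_ ->] := is_deriveM (is_derive_jop a b r Lx) (is_derive_cutoff k x).
have E1 k : \int[mu]_(x in @Lam R) (f x * ((phi k)^`())%classic x) =
    - \int[mu]_(x in @Lam R) (g x * phi k x).
  by have := H _ (tphi k); rewrite derive1n1 expr1 mulN1r.
have mphi k : measurable_fun (@Lam R) (phi k).
  by apply: measurable_fun_Lam; exact: test_fun_continuous.
have mphi' k : measurable_fun (@Lam R) ((phi k)^`())%classic.
  by apply: measurable_fun_Lam; apply: test_fun_continuous; exact: derive1_test_fun.
have C1 : \int[mu]_(x in @Lam R) (g x * phi k x) @[k --> \oo] --> wdot w1 g (horner r).
  have i1 := integrable_norm (wL2M mw1 w1_ge0 Hg (pw1 r)).
  apply: (cvg_Rintegral (g := fun x => `|g x * r.[x] * w1 x|)) => //.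
  - by move=> k; apply: measurable_funM => //; exact: mphi.
  - apply: measurable_funM => //; apply: measurable_funM => //.
    by apply: measurable_fun_Lam; exact: continuous_horner.
  - apply: aeW => x Lx; have c1 : cutoff (-1) 1 k x @[k --> \oo] --> (1 : R).
      by apply: cutoff_cvg1; rewrite -LamE.
    have c2 : (fun _ : nat => g x * r.[x] * w1 x) @ \oo --> g x * r.[x] * w1 x.
      exact: cvg_cst.
    have c3 := cvgM c2 c1; rewrite mulr1 in c3.
    rewrite (_ : (fun k => _) = (fun k => g x * r.[x] * w1 x * cutoff (-1) 1 k x)).
      exact: c3.
    by apply/funext => k; rewrite /phi /rho; ring.
  - move=> k x Lx; have -> : g x * phi k x = g x * r.[x] * w1 x * cutoff (-1) 1 k x.
      by rewrite /phi /rho; ring.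
    rewrite normrM ler_piMr//.
    by rewrite ger0_norm ?cutoff_ge0 ?cutoff_le1.
have C2 : \int[mu]_(x in @Lam R) (f x * ((phi k)^`())%classic x) @[k --> \oo] -->
    wdot w0 f (horner (jop a b r)).
  have i1 := integrable_norm (wL2M mw0 w0_ge0 Hf (pw0 (jop a b r))).
  (* The factor [12] is the bound of [cutoff_deriv_bound]. *)
  have i2 := RintegrableZ 12 mL (integrable_norm (wL2M mw0 w0_ge0 Hf (pw0 r))).
  (* Writing [w1] as [(1 - x^2) w0] attaches to the derivative of the cutoff exactly the factor that
     tames it. *)
  have E k x : Lam x -> f x * ((phi k)^`())%classic x =
      f x * (jop a b r).[x] * w0 x * cutoff (-1) 1 k x +
      ((1 - x) * (1 + x) * cutoff_deriv k x) * (f x * r.[x] * w0 x).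
    by move=> Lx; rewrite phi'E// /rho /w1 jweightS// -/w0; ring.
  apply: (cvg_Rintegral (g := fun x => `|f x * (jop a b r).[x] * w0 x| +
    12 * `|f x * r.[x] * w0 x|)) => //.
  - by move=> k; apply: measurable_funM => //; exact: mphi'.
  - apply: measurable_funM => //; apply: measurable_funM => //.
    by apply: measurable_fun_Lam; exact: continuous_horner.
  - apply: aeW => x Lx; under eq_fun do rewrite E//.
    have c1 : cutoff (-1) 1 k x @[k --> \oo] --> (1 : R).
      by apply: cutoff_cvg1; rewrite -LamE.
    have c2 : (fun _ : nat => f x * (jop a b r).[x] * w0 x) @ \oo -->
      f x * (jop a b r).[x] * w0 x by exact: cvg_cst.
    have c3 : (fun _ : nat => f x * r.[x] * w0 x) @ \oo --> f x * r.[x] * w0 x.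
      exact: cvg_cst.
    have c4 := cvgD (cvgM c2 c1) (cvgM (cutoff_deriv_cvg0 Lx) c3).
    by rewrite mulr1 mul0r addr0 in c4; exact: c4.
  - exact: RintegrableD.
  - move=> k x Lx; rewrite E// (le_trans (ler_normD _ _))// lerD//.
      by rewrite normrM ler_piMr// ger0_norm ?cutoff_ge0 ?cutoff_le1.
    by rewrite normrM ler_wpM2r// cutoff_deriv_bound.
have C1' : (fun k => - \int[mu]_(x in @Lam R) (g x * phi k x)) @ \oo -->
  - wdot w1 g (horner r) by apply: (cvgN C1).
rewrite (_ : (fun k => _) = (fun k => - \int[mu]_(x in @Lam R) (g x * phi k x))) in C2; last first.
  by apply/funext => k; exact: E1.
have e2 := cvg_lim (@Rhausdorff R) C2; have e1 := cvg_lim (@Rhausdorff R) C1'.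
by rewrite -e2 e1 opprK.
Qed.

End SturmLiouville.

(** * The Sturm-Liouville argument *)

Section ProjectionStep.
Variable R : realType.
Variables a b : R.
Hypotheses (a_gt : -1 < a) (b_ge0 : 0 <= b).
Implicit Types (f g : R -> R) (p q r s : {poly R}).

Let mL := @measurable_Lam R.
Let w0 := @jweight R a b.
Let w1 := @jweight R (a + 1) (b + 1).
Let a1_gt : -1 < a + 1. Proof. by rewrite (lt_trans a_gt)// ltrDl. Qed.
Let b1_ge0 : 0 <= b + 1. Proof. by rewrite addr_ge0. Qed.
Let mw0 : measurable_fun (@Lam R) w0. Proof. exact: measurable_jweight. Qed.
Let mw1 : measurable_fun (@Lam R) w1. Proof. exact: measurable_jweight. Qed.
Let w0_ge0 (x : R) (_ : Lam x) : 0 <= w0 x. Proof. exact: jweight_ge0. Qed.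
Let w1_ge0 (x : R) (_ : Lam x) : 0 <= w1 x. Proof. exact: jweight_ge0. Qed.
Let iw0 := integrable_jweight a_gt b_ge0.
Let iw1 := integrable_jweight a1_gt b1_ge0.
Let pw0 := horner_wL2 mw0 w0_ge0 iw0.
Let pw1 := horner_wL2 mw1 w1_ge0 iw1.

Definition jacobi_eig (n : nat) : R := n%:R * (n%:R + a + b + 1).

(* [- w^-1 (w (1-x^2) p')'] for the weight [w] of exponents [a], [b]; see
   [is_derive_jop]. *)
Definition jacobi_op p : {poly R} := - jop a b p^`().

Lemma jacobi_eig_le m n : (m <= n)%N -> jacobi_eig m <= jacobi_eig n.
Proof.
move=> mn; have mn' : m%:R <= n%:R :> R by rewrite ler_nat.
have m0 : 0 <= m%:R :> R by [].
by rewrite /jacobi_eig ler_pM//; move: a_gt b_ge0 => ? ?; lra.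
Qed.

Lemma coef_jop r j : (jop a b r)`_j.+1 =
  r`_j.+2 *+ j.+2 - r`_j *+ j + (b - a) * r`_j.+1 - (a + b + 2) * r`_j.
Proof.
have -> : jop a b r = r^`() - 'X * ('X * r^`()) + (b - a) *: r - (a + b + 2) *: ('X * r).
  by rewrite /jop -!mul_polyC !rmorphD !rmorphN /= polyC1; ring.
rewrite !(coefD, coefN, coefZ, coefXM, coef_deriv) /=.
by case: j => [|j] //=; rewrite mulr0n.
Qed.

Lemma size_jop r n : (size r <= n)%N -> (size (jop a b r) <= n.+1)%N.
Proof.
move=> sr; have r0 j : (n <= j)%N -> r`_j = 0.
  by move=> nj; rewrite nth_default// (leq_trans sr).
apply/leq_sizeP => -[//|j]; rewrite ltnS => nj.
by rewrite coef_jop !r0 ?mul0rn ?mulr0 ?subr0 ?addr0// (leq_trans nj)// ltnW.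
Qed.

Lemma size_deriv_le p n : (size p <= n.+1)%N -> (size p^`() <= n)%N.
Proof.
move=> sp; apply/leq_sizeP => j nj; rewrite coef_deriv nth_default ?mul0rn//.
by rewrite (leq_trans sp).
Qed.

Lemma size_jacobi_op p n : (size p <= n)%N -> (size (jacobi_op p) <= n)%N.
Proof.
rewrite /jacobi_op size_polyN; case: n => [|n] sp.
  move: sp; rewrite leqn0 size_poly_eq0 => /eqP ->.
  by rewrite /jop deriv0 deriv0 !mul0r addr0 size_poly0.
by apply: size_jop; exact: size_deriv_le.
Qed.

(** The operator is triangular on monomials; this is its diagonal. The factor [n] comes from [p']
    and the factor [n + a + b + 1] from the top coefficient of [jop]. *)
Lemma coef_jacobi_op p n : (size p <= n.+1)%N ->
  (jacobi_op p)`_n = jacobi_eig n * p`_n.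
Proof.
move=> sp; rewrite /jacobi_op coefN /jacobi_eig.
case: n sp => [|n] sp.
  have -> : p^`() = 0.
    by apply/eqP; rewrite -size_poly_eq0 -leqn0; exact: size_deriv_le.
  by rewrite /jop deriv0 !mul0r addr0 coef0 oppr0.
have p0 j : (n.+2 <= j)%N -> p`_j = 0.
  by move=> nj; rewrite nth_default// (leq_trans sp).
rewrite coef_jop !coef_deriv (p0 n.+2)// (p0 n.+3)// !mul0rn mulr0.
move: (p`_n.+1) => y.
rewrite -(mulr_natr (y *+ n.+1) n) -(mulr_natr y n.+1) -[n.+1%:R]natr1.
by move: (n%:R : R) => k; ring.
Qed.

Lemma jacobi_opD p q : jacobi_op (p + q) = jacobi_op p + jacobi_op q.
Proof. by rewrite /jacobi_op /jop !derivD; ring. Qed.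

Lemma jacobi_opZ c p : jacobi_op (c *: p) = c *: jacobi_op p.
Proof. by rewrite /jacobi_op /jop !derivZ -!mul_polyC; ring. Qed.

Let D p q := wdot w0 (horner p) (horner q).

Let DC p q : D p q = D q p. Proof. exact: wdotC. Qed.

Let DDl p q r : D (p + q) r = D p r + D q r.
Proof.
rewrite /D -wdotDl//; apply: eq_wdot => // x; exact: hornerD.
Qed.

Let DZl c p r : D (c *: p) r = c * D p r.
Proof. by rewrite /D -wdotZl//; apply: eq_wdot => // x; exact: hornerZ. Qed.

Let DDr p q r : D r (p + q) = D r p + D r q.
Proof. by rewrite !(DC r) DDl. Qed.

Let DZr c p r : D r (c *: p) = c * D r p.
Proof. by rewrite !(DC r) DZl. Qed.

(** The weak form of the operator. With [f] a polynomial it yields the symmetry of [jacobi_op]; with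
    [f] the projection error it brings in [e']. *)
Lemma wdot_jacobi_op f g p : wL2 w0 f -> wL2 w1 g -> is_weak_deriv 1 f g ->
  wdot w0 f (horner (jacobi_op p)) = wdot w1 g (horner p^`()).
Proof.
move=> Hf Hg fg; rewrite (weak_deriv_ibp a_gt b_ge0 _ Hf Hg fg).
rewrite (eq_wdot w0 (f' := f) (g' := fun x => (-1) * (jop a b p^`()).[x]))//.
  by rewrite wdotZr// mulN1r.
by move=> x; rewrite /jacobi_op hornerN mulN1r.
Qed.

Let D_jacobi_op p q : D q (jacobi_op p) = wdot w1 (horner q^`()) (horner p^`()).
Proof. exact: wdot_jacobi_op (is_weak_deriv_horner q). Qed.

Let D_sym p q : D q (jacobi_op p) = D p (jacobi_op q).
Proof. by rewrite !D_jacobi_op wdotC. Qed.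

(** Induction on the degree, splitting off a multiple of the monic orthogonal polynomial [J]. All
    cross terms between [J] and the remainder vanish by orthogonality and symmetry, so the two
    quadratic forms add up. *)
Lemma jacobi_rayleigh M n q : (size q <= n)%N ->
  (forall r, (size r <= M)%N -> wdot w0 (horner q) (horner r) = 0) ->
  jacobi_eig M * wdot w0 (horner q) (horner q) <=
  wdot w0 (horner q) (horner (jacobi_op q)).
Proof.
rewrite -/(D q q) -/(D q (jacobi_op q)).
(* In these degrees [p] is orthogonal both to itself and to its image, so both sides are [0]. *)
have small k p : (size p <= k)%N -> (k <= M)%N ->
    (forall r, (size r <= M)%N -> wdot w0 (horner p) (horner r) = 0) ->
    jacobi_eig M * D p p <= D p (jacobi_op p).
  move=> sp kM Hp; rewrite {1}/D Hp ?(leq_trans sp)// mulr0.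
  by rewrite /D Hp// (leq_trans (size_jacobi_op sp)).
elim: n q => [|n IH] q sq Hq; first exact: small sq _ Hq.
have [nM|Mn] := ltnP n M; first exact: small sq nM Hq.
have [s ss Hs] := orth_proj_exists mw0 w0_ge0 iw0 n (pw0 'X^n).
pose J := 'X^n - s; pose c := q`_n.
have J0 r : (size r <= n)%N -> D J r = 0.
  move=> sr; rewrite -(Hs r sr); apply: eq_wdot => // x.
  by rewrite /J hornerD hornerN.
have sJ : (size J <= n.+1)%N.
  by rewrite (leq_trans (size_polyD _ _))// geq_max size_polyN size_polyXn leqnn/= ltnW.
have Jn : J`_n = 1 by rewrite /J coefB coefXn eqxx (nth_default 0 ss) subr0.
have slower p : (size p <= n.+1)%N -> (size (p - p`_n *: J)%R <= n)%N.
  move=> sp; apply/leq_sizeP => j nj; rewrite coefB coefZ.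
  move: nj; rewrite leq_eqVlt => /predU1P[<-|nj]; first by rewrite Jn mulr1 subrr.
  by rewrite (nth_default 0 (leq_trans sp nj)) (nth_default 0 (leq_trans sJ nj)) mulr0 subrr.
pose r := q - c *: J.
have sr : (size r <= n)%N by exact: slower.
have qE : q = c *: J + r by rewrite /r addrC subrK.
have Hr (t : {poly R}) : (size t <= M)%N -> wdot w0 (horner r) (horner t) = 0.
  move=> st; rewrite -/(D r t); have := Hq t st; rewrite -/(D q t) qE DDl DZl.
  by rewrite J0 ?(leq_trans st)// mulr0 add0r.
(* The image of [J] minus [jacobi_eig n] times [J] has lower degree, hence is orthogonal to [J]. *)
have JJ : D J (jacobi_op J) = jacobi_eig n * D J J.
  have := J0 _ (slower (jacobi_op J) (size_jacobi_op sJ)).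
  rewrite coef_jacobi_op// Jn mulr1 DDr -scaleNr DZr => /eqP.
  by rewrite mulNr subr_eq0 => /eqP.
have Jr := J0 _ sr; have JLr := J0 _ (size_jacobi_op sr).
have rLJ : D r (jacobi_op J) = 0 by rewrite D_sym.
have IHr := IH r sr Hr.
clearbody r c; rewrite qE jacobi_opD jacobi_opZ !DDl !DDr !DZl !DZr.
rewrite (DC r J) Jr JLr rLJ JJ !mulr0 !addr0 !add0r mulrDr lerD//.
have J2 : 0 <= D J J by exact: wdot_ge0.
have H : 0 <= c ^+ 2 * D J J * (jacobi_eig n - jacobi_eig M).
  by apply: mulr_ge0; [apply: mulr_ge0 => //; exact: sqr_ge0|rewrite subr_ge0 jacobi_eig_le].
by rewrite -subr_ge0 (_ : _ - _ = c ^+ 2 * D J J * (jacobi_eig n - jacobi_eig M))//; ring.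
Qed.

Let le_of_sqrB (x y : R) : 0 <= x - 2 * y + y -> y <= x.
Proof. by lra. Qed.

(** The Rayleigh bound is applied to a projection [s] of the error [e] to a high degree. Since
    [|e|^2 = |s|^2 + |d|^2] with [d = e - s], density has only to make [|d|] small. *)
Lemma jacobi_poincare f g N q : wL2 w0 f -> wL2 w1 g -> is_weak_deriv 1 f g ->
  (forall r, (size r <= N.+1)%N -> wdot w0 (fun x => f x - q.[x]) (horner r) = 0) ->
  jacobi_eig N.+1 * wdot w0 (fun x => f x - q.[x]) (fun x => f x - q.[x]) <=
  wdot w1 (fun x => g x - q^`().[x]) (fun x => g x - q^`().[x]).
Proof.
move=> Hf Hg fg Hq.
pose e x := f x - q.[x]; pose e' x := g x - q^`().[x].
have He : wL2 w0 e by exact: wL2B.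
have He' : wL2 w1 e' by exact: wL2B.
have ee' : is_weak_deriv 1 e e' by apply: is_weak_derivB => //; exact: is_weak_deriv_horner.
rewrite -/e -/e' in Hq *.
have lam0 : 0 < jacobi_eig N.+1.
  rewrite /jacobi_eig mulr_gt0//.
  have : 0 <= N.+1%:R :> R by [].
  by move: a_gt b_ge0 => ? ? ?; lra.
apply/ler_addgt0Pr => eps eps0.
have [_ /(_ (eps / jacobi_eig N.+1)) []] := poly_dense mw0 w0_ge0 iw0 He.
  by rewrite divr_gt0.
move=> p; rewrite ltr_pdivlMr// => Hp.
(* At least [size p], so that [s] approximates [e] no worse than [p] does; at least [N.+1], so that
   [s] inherits the orthogonality of [e]. *)
pose n := maxn (size p) N.+1.
have [s ss Hs] := orth_proj_exists mw0 w0_ge0 iw0 n He.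
pose d x := e x - s.[x]; rewrite -/d in Hs.
have Hd : wL2 w0 d by exact: wL2B.
have dr r : (size r <= n)%N -> wdot w0 e (horner r) = wdot w0 (horner s) (horner r).
  by move=> sr; apply/eqP; rewrite -subr_eq0 -wdotBl// Hs.
have dle : wdot w0 d d <= wdot w0 (fun x => e x - p.[x]) (fun x => e x - p.[x]).
  rewrite (eq_wdot w0 (f := fun x => e x - p.[x]) (g := fun x => e x - p.[x])
    (f' := fun x => d x - (p - s).[x]) (g' := fun x => d x - (p - s).[x])); last 2 first.
  - by move=> x; rewrite /d hornerD hornerN; ring.
  - by move=> x; rewrite /d hornerD hornerN; ring.
  rewrite (wdot_sqrB mw0 w0_ge0 Hd)// Hs; last first.
    rewrite (leq_trans (size_polyD _ _))// geq_max size_polyN ss andbT.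
    exact: leq_maxl.
  by rewrite mulr0 subr0 lerDl wdot_ge0.
have eE : wdot w0 e e = wdot w0 (horner s) (horner s) + wdot w0 d d.
  rewrite (eq_wdot w0 (f := e) (g := e)
    (f' := fun x => d x - (- s).[x]) (g' := fun x => d x - (- s).[x])); last 2 first.
  - by move=> x; rewrite /d hornerN; ring.
  - by move=> x; rewrite /d hornerN; ring.
  rewrite (wdot_sqrB mw0 w0_ge0 Hd)// Hs ?size_polyN// mulr0 subr0 addrC.
  by congr (_ + _); apply: eq_Rintegral => x _; rewrite hornerN mulrNN.
have sN r : (size r <= N.+1)%N -> wdot w0 (horner s) (horner r) = 0.
  by move=> sr; rewrite -dr ?Hq// (leq_trans sr)// leq_maxr.
have ray := jacobi_rayleigh ss sN.
(* [jacobi_op] does not raise the degree, so [s] may be replaced by [e] in this product. Together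
   with [E2] this gives [<e', s'> = <s', s'>], and then [|e' - s'|^2 >= 0] bounds [|s'|] by
   [|e'|]. *)
have E1 : wdot w0 (horner s) (horner (jacobi_op s)) = wdot w1 e' (horner s^`()).
  exact: etrans (esym (dr _ (size_jacobi_op ss))) (wdot_jacobi_op s He He' ee').
have E2 : wdot w0 (horner s) (horner (jacobi_op s)) = wdot w1 (horner s^`()) (horner s^`()).
  exact: D_jacobi_op.
have := wdot_ge0 w1_ge0 (fun x => e' x - s^`().[x]).
rewrite (wdot_sqrB mw1 w1_ge0 He')// -E1 -E2 => pos.
rewrite eE mulrDr; apply: lerD; first exact: le_trans ray (le_of_sqrB pos).
apply: le_trans (ltW Hp); rewrite [leRHS]mulrC.
by rewrite (ler_pM2l lam0).
Qed.

(** Moving the derivative to the other side turns the test polynomial [r] into [jop a b r], of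
    degree at most one higher, which is still within the orthogonality of the error. *)
Lemma proj_deriv f g N q : wL2 w0 f -> wL2 w1 g -> is_weak_deriv 1 f g ->
  (forall r, (size r <= N.+1)%N -> wdot w0 (fun x => f x - q.[x]) (horner r) = 0) ->
  forall r, (size r <= N)%N -> wdot w1 (fun x => g x - q^`().[x]) (horner r) = 0.
Proof.
move=> Hf Hg fg Hq r sr.
rewrite (weak_deriv_ibp a_gt b_ge0 r (wL2B mw0 w0_ge0 Hf (pw0 q)) (wL2B mw1 w1_ge0 Hg (pw1 _))).
  by rewrite Hq ?oppr0// size_jop.
by apply: is_weak_derivB => //; exact: is_weak_deriv_horner.
Qed.

End ProjectionStep.

(** * Iterating the estimate, and the norms as real numbers *)

Section ProjectionError.
Variable R : realType.
Local Notation mu := (@lebesgue_measure R).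
Implicit Types (f g : R -> R) (q r : {poly R}) (a b : R).

Let mL := @measurable_Lam R.

Lemma wdot_proj_le a b f q n : -1 < a -> 0 <= b -> wL2 (jweight a b) f ->
  (size q <= n)%N ->
  (forall r, (size r <= n)%N ->
    wdot (jweight a b) (fun x => f x - q.[x]) (horner r) = 0) ->
  wdot (jweight a b) (fun x => f x - q.[x]) (fun x => f x - q.[x]) <=
  wdot (jweight a b) f f.
Proof.
move=> a1 b0 Hf sq Hq; have mw := @measurable_jweight R a b (@Lam R).
have w_ge0 x : Lam x -> 0 <= jweight a b x by move=> _; exact: jweight_ge0.
have iw := integrable_jweight a1 b0; have Hp := horner_wL2 mw w_ge0 iw q.
have := Hq _ sq; rewrite wdotBl// => /eqP; rewrite subr_eq0 => /eqP E.
rewrite wdot_sqrB// E; have := wdot_ge0 w_ge0 (horner q); lra.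
Qed.

Lemma jacobi_eig_ge a (N i : nat) : -1 < a -> (i <= N)%N ->
  N%:R * (N.+1 - i)%:R <= jacobi_eig (a + i%:R) i%:R (N.+1 - i).
Proof.
move=> a1 iN; rewrite /jacobi_eig mulrC ler_wpM2l//.
have i0 : 0 <= i%:R :> R by [].
rewrite natrB 1?ltnW// -natr1; lra.
Qed.

(** The factors [N (N+1-k)] for [k < m] multiply to [N^m] times a falling factorial, the reciprocal
    of [(N-m+1)! / (N^m (N+1)!)], which is the square of the constant sought. *)
Lemma proj_error_iter (G : nat -> R -> R) a (m N : nat) q : -1 < a -> (m <= N)%N ->
  (forall l, (l <= m)%N -> wL2 (jweight (a + l%:R) l%:R) (G l)) ->
  (forall l, (l < m)%N -> is_weak_deriv 1 (G l) (G l.+1)) ->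
  (size q <= N.+1)%N ->
  (forall r, (size r <= N.+1)%N ->
    wdot (jweight a 0) (fun x => G 0 x - q.[x]) (horner r) = 0) ->
  N%:R ^+ m * (N.+1 ^_ m)%:R *
    wdot (jweight a 0) (fun x => G 0 x - q.[x]) (fun x => G 0 x - q.[x]) <=
  wdot (jweight (a + m%:R) m%:R) (G m) (G m).
Proof.
move=> a1 mN HG HD sq Hq.
set E0 := wdot _ _ _.
(* The witness [s] is the [k]-th derivative of [q]; its degree bound and the range of orthogonality
   drop by one at each step. *)
have step k : (k <= m)%N -> exists s : {poly R}, [/\ (size s <= N.+1 - k)%N,
    forall r, (size r <= N.+1 - k)%N ->
      wdot (jweight (a + k%:R) k%:R) (fun x => G k x - s.[x]) (horner r) = 0 &
    N%:R ^+ k * (N.+1 ^_ k)%:R * E0 <=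
      wdot (jweight (a + k%:R) k%:R) (fun x => G k x - s.[x]) (fun x => G k x - s.[x])].
  elim: k => [|k IH] km.
    by exists q; rewrite subn0 addr0; split=> //; rewrite expr0 ffactn0 !mul1r.
  have [s [ss Hs Es]] := IH (ltnW km).
  have kN : (k < N)%N := leq_trans km mN.
  have ak : -1 < a + k%:R by rewrite (lt_le_trans a1)// lerDl.
  have Nk : (N.+1 - k = (N - k).+1)%N by rewrite subSn// ltnW.
  have kk : (k <= m)%N := ltnW km.
  have aS : a + k.+1%:R = a + k%:R + 1 by rewrite -addrA natr1.
  have bS : k.+1%:R = k%:R + 1 :> R by rewrite natr1.
  have HS := HG _ km; rewrite aS bS in HS.
  rewrite Nk in ss Hs.
  exists s^`(); rewrite subSS aS bS; split.
  - exact: size_deriv_le.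
  - exact: (proj_deriv ak (ler0n _ k) (HG _ kk) HS (HD _ km) Hs).
  - apply: le_trans (jacobi_poincare ak (ler0n _ k) (HG _ kk) HS (HD _ km) Hs).
    have Hk := jacobi_eig_ge a1 (ltnW kN); rewrite Nk in Hk.
    have E0_ge0 : 0 <= E0 by apply: wdot_ge0 => x _; exact: jweight_ge0.
    rewrite exprSr ffactnSr natrM Nk.
    move: Es Hk E0_ge0; clear; move: (wdot _ _ _) E0 (jacobi_eig _ _ _) => W E0 eig Es Hk E0_ge0.
    have c0 : 0 <= N%:R * (N - k).+1%:R :> R by rewrite mulr_ge0.
    have c1 : 0 <= N%:R ^+ k * (N.+1 ^_ k)%:R * E0 :> R.
      by rewrite !mulr_ge0 ?exprn_ge0.
    apply: le_trans (ler_pM c0 c1 Hk Es).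
    by rewrite le_eqVlt; apply/orP; left; apply/eqP; ring.
have [s [ss Hs Es]] := step m (leqnn m).
(* After [m] steps the remaining error is at most the norm of [G m] itself. *)
apply: le_trans Es _; apply: wdot_proj_le ss Hs => //.
  by rewrite (lt_le_trans a1)// lerDl.
exact: HG.
Qed.

Lemma in_L2P a b f : in_L2 a b f <-> wL2 (jweight a b) f.
Proof.
have J0 x : 0 <= f x ^+ 2 * jweight a b x by rewrite mulr_ge0 ?sqr_ge0// jweight_ge0.
have J x : (`|(f x ^+ 2 * jweight a b x)%:E| = (f x ^+ 2 * jweight a b x)%:E)%E.
  by rewrite gee0_abs// lee_fin.
have I0 : (0 <= \int[mu]_(x in @Lam R) (f x ^+ 2 * jweight a b x)%:E)%E.
  by apply: integral_ge0 => x _; rewrite lee_fin.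
split=> -[mf Hf]; split => //.
  apply/integrableP; split.
    apply/measurable_EFinP; apply: measurable_funM; last exact: measurable_jweight.
    exact: measurable_funX.
  under eq_integral do rewrite J.
  move: Hf; rewrite /jnorm; case: (integral _ _ _) I0 => [r _ _|_|//]; first exact: ltry.
  by rewrite poweRyr.
rewrite /jnorm.
have -> : (\int[mu]_(x in Lam (R:=R)) (f x ^+ 2 * jweight a b x)%:E)%E =
  (\int[mu]_(x in @Lam R) (f x ^+ 2 * jweight a b x))%:E.
  by rewrite /Rintegral fineK// integrable_fin_num.
by rewrite poweR_EFin ltry.
Qed.

Lemma jnormE a b f : wL2 (jweight a b) f ->
  jnorm a b f = (Num.sqrt (wdot (jweight a b) f f))%:E.
Proof.
move=> [mf if_]; rewrite /jnorm.
have -> : (\int[mu]_(x in Lam (R:=R)) (f x ^+ 2 * jweight a b x)%:E)%E =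
  (\int[mu]_(x in @Lam R) (f x ^+ 2 * jweight a b x))%:E.
  by rewrite /Rintegral fineK// integrable_fin_num.
rewrite poweR_EFin powR12_sqrt//; last first.
  by apply: Rintegral_ge0 => x _; rewrite mulr_ge0 ?sqr_ge0// jweight_ge0.
Qed.

Lemma ae_eq_jnorm a b f g : measurable_fun (@Lam R) f -> measurable_fun (@Lam R) g ->
  {ae mu, forall x, Lam x -> f x = g x} -> jnorm a b f = jnorm a b g.
Proof.
move=> mf mg fg; rewrite /jnorm; congr (_ `^ _)%E.
have mJ (h : R -> R) : measurable_fun (@Lam R) h ->
    measurable_fun (@Lam R) (fun x => (h x ^+ 2 * jweight a b x)%:E).
  move=> mh; apply/measurable_EFinP; apply: measurable_funM; last exact: measurable_jweight.
  exact: measurable_funX.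
apply: ae_eq_integral => //; [exact: mJ|exact: mJ|].
by apply: ae_mono fg => x fg Lx; rewrite fg.
Qed.

Lemma jnorm_sym a b f g : jnorm a b (fun x => f x - g x) = jnorm a b (fun x => g x - f x).
Proof.
by rewrite /jnorm; congr (_ `^ _)%E; apply: eq_integral => x _; congr (_ * _)%:E; ring.
Qed.

End ProjectionError.

(** * Riemann-Liouville derivatives *)

Section RiemannLiouville.
Variable R : realType.
Local Notation mu := (@lebesgue_measure R).
Implicit Types (s x y : R) (v f g u p : R -> R).

Let mL := @measurable_Lam R.

Lemma RL_order_addn s l : 0 <= s -> RL_order (s + l%:R) = (RL_order s + l)%N.
Proof.
move=> s0; rewrite /RL_order addSn; congr _.+1; apply: truncn_def.
have /andP[h1 h2] := truncn_itv s0.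
by rewrite natrD lerD2r h1/= -addSn natrD ltrD2r.
Qed.

(** The kernel and the Gamma factor depend on [s] only through [RL_order s - s], which an integer
    shift preserves. *)
Lemma RL_potential_addn s l v : 0 <= s -> RL_potential (s + l%:R) v = RL_potential s v.
Proof.
move=> s0; have E : (RL_order (s + l%:R))%:R - (s + l%:R) = (RL_order s)%:R - s.
  by rewrite RL_order_addn// natrD; ring.
apply/funext => x; rewrite /RL_potential E; congr (_ * _).
by apply: eq_Rintegral => y _; rewrite /RL_kernel E.
Qed.

Lemma RLderivP s v : RLderivable s v -> is_RLderiv s v (RLderiv s v).
Proof. by move=> [g Hg]; exact: (xgetPex (cst 0) (ex_intro _ g Hg)). Qed.

(** The relation of order [j] is tested against [phi'], which is again a test function, and compared
    with the relation of order [j.+1] tested against [phi]. *)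
Lemma is_weak_deriv_chain j f g h : is_weak_deriv j f g -> is_weak_deriv j.+1 f h ->
  is_weak_deriv 1 g h.
Proof.
move=> [_ lg Hg] [_ lh Hh]; split => // phi tphi.
have := Hh _ tphi; have := Hg _ (derive1_test_fun tphi).
rewrite -derive1Sn => -> /eqP; rewrite exprSr -mulrA.
have n0 : (-1) ^+ j != 0 :> R by rewrite expf_neq0// oppr_eq0 oner_eq0.
by rewrite (inj_eq (mulfI n0)) derive1n1 expr1 => /eqP ->.
Qed.

Lemma RLderiv_weak_deriv s u l : 0 <= s ->
  RLderivable (s + l%:R) u -> RLderivable (s + l.+1%:R) u ->
  is_weak_deriv 1 (RLderiv (s + l%:R) u) (RLderiv (s + l.+1%:R) u).
Proof.
move=> s0 /RLderivP [_ H1] /RLderivP [_ H2].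
rewrite (RL_potential_addn l u s0) (RL_order_addn l s0) in H1.
rewrite (RL_potential_addn l.+1 u s0) (RL_order_addn l.+1 s0) addnS in H2.
move: H1 H2.
exact: is_weak_deriv_chain.
Qed.

Lemma RL_kernel_gt0 s x y : y < x -> 0 < RL_kernel s x y.
Proof. by move=> yx; rewrite powR_gt0// subr_gt0. Qed.

Lemma ae_Lam_near1 (P : R -> Prop) (n : nat) :
  {ae mu, forall x, Lam x -> P x} -> exists2 x, 1 - n.+1%:R^-1 < x < 1 & P x.
Proof.
move=> [N [mN N0 HN]]; apply: contrapT => H.
have n0 : 0 < n.+1%:R^-1 :> R by rewrite invr_gt0.
have n1 : n.+1%:R^-1 <= 1 :> R by rewrite invf_le1 ?ler1n.
have sub : `]1 - n.+1%:R^-1, 1[%classic `<=` N.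
  move=> x /=; rewrite in_itv/= => /andP[x1 x2]; apply: HN => /= HP; apply: H.
  exists x; first by rewrite x1.
  by apply: HP; rewrite LamE x2 andbT (le_lt_trans _ x1)// lerBrDl; move: n1; set z := _^-1; lra.
pose I : set (measurableTypeR R) := `]1 - n.+1%:R^-1, 1[%classic.
have : (mu I <= mu N)%E.
  by apply: le_measure => //; apply/mem_set => //; exact: measurable_itv.
rewrite N0 /I lebesgue_measure_itv/= lte_fin ltrBlDr ltrDl n0 -EFinD lee_fin opprB addrC subrK.
by rewrite leNgt n0.
Qed.

(** Measurability of [v] is not part of [is_RLderiv]. It is recovered from that of [v] times the
    kernel by dividing by the positive kernel on intervals []-1, X n[] that exhaust [Lam]. *)
Lemma measurable_of_RL s v :
  {ae mu, forall x, Lam x ->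
    mu.-integrable `]-1, x[%classic (fun y => (v y * RL_kernel s x y)%:E)} ->
  measurable_fun (@Lam R) v.
Proof.
move=> H; have /choice [X HX] n : exists x, 1 - n.+1%:R^-1 < x < 1 /\
    mu.-integrable `]-1, x[%classic (fun y => (v y * RL_kernel s x y)%:E).
  by have [x x1 x2] := ae_Lam_near1 n H; exists x.
have -> : @Lam R = \bigcup_n `]-1, X n[%classic.
  apply/seteqP; split => x.
    rewrite LamE => /andP[x1 x2]; have /ltr_add_invr[n] : 0 < 1 - x by rewrite subr_gt0.
    rewrite add0r => Hn; exists n => //=; rewrite in_itv/= x1/=.
    have [/andP[XX _] _] := HX n; apply: lt_trans XX.
    by rewrite ltrBrDr addrC -ltrBrDr.
  move=> [n _ /=]; rewrite in_itv/= LamE => /andP[-> xX]; have [/andP[_ X1] _] := HX n.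
  exact: lt_trans X1.
apply/measurable_fun_bigcup => [n|n]; first exact: measurable_itv.
have [_ /(measurable_int mu) /measurable_EFinP mv] := HX n.
have mk : measurable_fun (`]-1, X n[%classic : set (measurableTypeR R))
    (fun y => (X n - y) `^ (- ((RL_order s)%:R - s - 1))).
  apply: measurable_funTS; apply: (measurableT_comp (measurable_powR _)).
  by apply: measurable_funB.
have := measurable_funM mv mk.
apply: eq_measurable_fun => y /set_mem /=; rewrite in_itv/= => /andP[_ yX].
rewrite powRN -mulrA mulfV ?mulr1// gt_eqF//; exact: RL_kernel_gt0.
Qed.

(* [lebesgue_measure] is not completed: the potential of [v - v'] agrees only almost
   everywhere with a difference of measurable potentials, which is not enough. *)
Lemma measurable_RL_potential s v : measurable_fun (@Lam R) v ->
  measurable_fun (@Lam R) (RL_potential s v).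
Proof.
move=> mv.
pose V : measurableTypeR R -> R := v \_ (@Lam R).
have mV : measurable_fun setT V by apply/(measurable_restrict _ mL measurableT); rewrite setTI.
pose G (z : measurableTypeR R * measurableTypeR R) : R :=
  if z.2 < z.1 then V z.2 * RL_kernel s z.1 z.2 else 0.
have mG : measurable_fun setT (EFin \o G).
  apply/measurable_EFinP; apply: measurable_fun_ifT => //.
    by apply: measurable_fun_ltr.
  apply: measurable_funM; first exact: measurableT_comp.
  apply: (measurableT_comp (measurable_powR _)); exact: measurable_funB.
(* [G] need not be integrable on the plane, so Tonelli is applied to its positive and negative parts
   separately. *)
have mp : measurable_fun setT (fun x : measurableTypeR R => \int[mu]_y ((EFin \o G)^\+ (x, y)))%E.
  apply: (measurable_fun_fubini_tonelli_F (m2 := mu) (EFin \o G)^\+%E).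
    exact: measurable_funepos.
  by move=> z; exact: funepos_ge0.
have mn : measurable_fun setT (fun x : measurableTypeR R => \int[mu]_y ((EFin \o G)^\- (x, y)))%E.
  apply: (measurable_fun_fubini_tonelli_F (m2 := mu) (EFin \o G)^\-%E).
    exact: measurable_funeneg.
  by move=> z; exact: funeneg_ge0.
apply: measurable_funM => //.
have mI := emeasurable_funB mp mn.
have : measurable_fun (@Lam R : set (measurableTypeR R)) (fine \o (fun x : measurableTypeR R =>
    \int[mu]_y ((EFin \o G)^\+ (x, y)) - \int[mu]_y ((EFin \o G)^\- (x, y)))%E).
  apply: measurable_funTS; apply: measurableT_comp => //; exact: fine_measurable.
apply: eq_measurable_fun => x /set_mem Lx.
rewrite /= /Rintegral integral_mkcond; congr fine; rewrite [RHS]integralE.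
have E y : ((fun y => (v y * RL_kernel s x y)%:E) \_ `]-1, x[) y = (G (x, y))%:E.
  rewrite patchE /G /= mem_setE in_itv/=; case: (ltP y x) => yx; last by rewrite andbF.
  rewrite andbT /V patchE; move: Lx; rewrite LamE => /andP[_ x1].
  case: ifPn => y1; first by rewrite mem_set// LamE y1/= (lt_trans yx).
  rewrite memNset ?mul0r// LamE => /andP[y2 _]; by rewrite y2 in y1.
congr (_ - _)%E; apply: eq_integral => y _.
- by rewrite !funeposE /= E.
- by rewrite !funenegE /= E.
Qed.

Lemma locally_integrable_ae f g : locally_integrable (@Lam R) f ->
  measurable_fun (@Lam R) g -> {ae mu, forall x, Lam x -> f x = g x} ->
  locally_integrable (@Lam R) g.
Proof.
move=> [mf oL Hf] mg fg; split => // K KL cK.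
have mK : measurable (K : set (measurableTypeR R)) by exact: compact_measurable.
rewrite (_ : (\int[mu]_(x in K) `|g x|%:E)%E = (\int[mu]_(x in K) `|f x|%:E)%E).
  exact: Hf.
apply: ae_eq_integral => //.
- apply/measurable_EFinP; apply: measurableT_comp => //.
  exact: measurable_funS mL KL mg.
- apply/measurable_EFinP; apply: measurableT_comp => //.
  exact: measurable_funS mL KL mf.
by apply: ae_mono fg => x fg /KL /fg ->.
Qed.

Lemma is_weak_deriv_ae j f f' g : is_weak_deriv j f g ->
  measurable_fun (@Lam R) f' -> {ae mu, forall x, Lam x -> f x = f' x} ->
  is_weak_deriv j f' g.
Proof.
move=> [lf lg H] mf' ff'; split => //; first exact: locally_integrable_ae ff'.
move=> phi tphi; rewrite -H//; congr fine.
have mphi : measurable_fun (@Lam R) ((phi^`(j))%classic).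
  by apply: measurable_fun_Lam; apply: test_fun_continuous; exact: derive1n_test_fun.
have [mf _ _] := lf.
apply: ae_eq_integral => //.
- by apply/measurable_EFinP; exact: measurable_funM.
- by apply/measurable_EFinP; exact: measurable_funM.
by apply: ae_mono ff' => x E Lx; rewrite E.
Qed.

(** The potentials subtract only at points where both integrals converge, hence the detour through
    [is_weak_deriv_ae]. *)
Lemma is_RLderivB s v v' g g' : is_RLderiv s v g -> is_RLderiv s v' g' ->
  is_RLderiv s (v \- v') (fun x => g x - g' x).
Proof.
move=> [i1 H1] [i2 H2]; split.
  apply: ae_mono2 i1 i2 => x i1 i2 Lx.
  have := integrableB _ (i1 Lx) (i2 Lx).
  move=> /(_ (measurable_itv _)); apply: eq_integrable => [|y _]; first exact: measurable_itv.
  by rewrite /= -EFinB mulrBl.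
have mB : measurable_fun (@Lam R) (v \- v').
  by apply: measurable_funB; [exact: measurable_of_RL i1|exact: measurable_of_RL i2].
apply: is_weak_deriv_ae (is_weak_derivB H1 H2) (measurable_RL_potential s mB) _.
apply: ae_mono2 i1 i2 => x i1 i2 Lx.
rewrite /RL_potential -mulrBr; congr (_ * _).
rewrite -RintegralB; [|exact: measurable_itv|exact: i1|exact: i2].
by apply: eq_Rintegral => y _; rewrite /= mulrBl.
Qed.

(** [RLderiv] is picked by [xget]; this makes the norms below independent of the pick. *)
Lemma RLderiv_unique s v g g' : is_RLderiv s v g -> is_RLderiv s v g' ->
  {ae mu, forall x, Lam x -> g x = g' x}.
Proof.
move=> [_ [_ lg H]] [_ [_ lg' H']].
have : {ae mu, forall x, Lam x -> (fun x => g x - g' x) x = 0}.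
  apply: locally_integrable_ae0; first exact: locally_integrableB.
  move=> phi tphi; under eq_Rintegral do rewrite mulrBl.
  rewrite RintegralB//; [|exact: integrable_test_fun..].
  have := H _ tphi; rewrite H'// => /eqP.
  have n0 : (-1) ^+ RL_order s != 0 :> R by rewrite expf_neq0// oppr_eq0 oner_eq0.
  by rewrite (inj_eq (mulfI n0)) => /eqP ->; rewrite subrr.
by apply: ae_mono => x E Lx; apply/eqP; rewrite -subr_eq0 E.
Qed.

End RiemannLiouville.

(** * The asymptotic constant and the final bound *)

Section Constants.
Variable R : realType.

(** The square of the constant [c_N]. Raising [m] by one multiplies the ratio by [N / (N+1-m)],
    which tends to [1]. *)
Lemma ffact_ratio_cvg1 (m : nat) :
  (N%:R ^+ m / (N.+1 ^_ m)%:R : R) @[N --> \oo] --> (1 : R).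
Proof.
elim: m => [|m IH].
  rewrite (_ : (fun N => _) = cst 1); first exact: cvg_cst.
  by apply/funext => N; rewrite expr0 ffactn0 divr1.
have H1 : (N%:R^-1 : R) @[N --> \oo] --> (0 : R).
  apply/gtr0_cvgV0; last exact: cvgr_idn.
  by near=> N; rewrite ltr0n; near: N; exact: nbhs_infty_gt.
have H2 : ((N.+1 - m)%:R / N%:R : R) @[N --> \oo] --> (1 : R).
  have c0 : (fun _ : nat => 1 - m%:R : R) @ \oo --> (1 - m%:R : R) by exact: cvg_cst.
  have c1 : (fun _ : nat => 1 : R) @ \oo --> (1 : R) by exact: cvg_cst.
  have c2 := cvgD c1 (cvgM c0 H1); rewrite mulr0 addr0 in c2.
  have c3 : (fun N : nat => 1 + (1 - m%:R) * N%:R^-1 : R) @ \oo --> (1 : R) by exact: c2.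
  apply: cvg_trans c3; apply: near_eq_cvg; near=> N.
  have N0 : (0 < N)%N by near: N; exact: nbhs_infty_gt.
  have mN : (m <= N)%N by near: N; exact: nbhs_infty_ge.
  have Nn : N%:R != 0 :> R by rewrite pnatr_eq0 -lt0n.
  by rewrite natrB 1?ltnW// -natr1; move: Nn; move: (N%:R : R) => y y0; field.
have H3 : (((N.+1 - m)%:R / N%:R)^-1 : R) @[N --> \oo] --> (1 : R).
  by rewrite -[X in _ --> X]invr1; apply: cvgV.
have H4 : (N%:R ^+ m / (N.+1 ^_ m)%:R * ((N.+1 - m)%:R / N%:R)^-1 : R) @[N --> \oo] --> (1 : R).
  by rewrite -[X in _ --> X]mulr1; apply: cvgM.
apply: cvg_trans H4; apply: near_eq_cvg; apply: nearW => N.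
by rewrite ffactnSr natrM exprSr invf_div mulf_div.
Unshelve. all: by end_near. Qed.

End Constants.

Section Bound.
Variables (R : realType) (alpha beta : R) (m : nat).
Hypotheses (beta_gt0 : 0 < beta) (alpha_gt : - beta - 1 < alpha).

(** Both forms of the estimate are deduced from this one; the real squared norms [A] and [B] keep
    extended-real arithmetic out of them. *)
Lemma gjf_proj_error (N : nat) (u p : R -> R) :
  (m <= N)%N ->
  (forall l : nat, (l <= m)%N ->
     RLderiv_in_L2 (beta + l%:R) u (alpha + beta + l%:R) l%:R) ->
  is_gjf_proj N alpha beta u p ->
  RLderivable beta (p \- u) /\ exists A B : R,
    [/\ jnorm (alpha + beta) 0 (RLderiv beta (p \- u)) = (Num.sqrt A)%:E,
        jnorm (alpha + beta + m%:R) m%:R (RLderiv (beta + m%:R) u) = (Num.sqrt B)%:E,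
        0 <= B & N%:R ^+ m * (N.+1 ^_ m)%:R * A <= B].
Proof.
move=> mN Hu [_ [q [sq Hq] pq]]; set a := alpha + beta.
have a1 : -1 < a by rewrite /a; move: alpha_gt => ?; lra.
have b0 := ltW beta_gt0.
pose G l := RLderiv (beta + l%:R) u.
have HG l : (l <= m)%N -> wL2 (jweight (a + l%:R) l%:R) (G l).
  by move=> /Hu [_] /in_L2P.
have HD l : (l < m)%N -> is_weak_deriv 1 (G l) (G l.+1).
  move=> lm; apply: RLderiv_weak_deriv => //; first by have [] := Hu _ (ltnW lm).
  by have [] := Hu _ lm.
have [du _] := Hu 0%N (leq0n m); rewrite mulr0n addr0 in du.
have G0 : G 0%N = RLderiv beta u by rewrite /G mulr0n addr0.
have HB := is_RLderivB pq (RLderivP du).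
have dpu : RLderivable beta (p \- u) by eexists; exact: HB.
split; first exact: dpu.
have G0L2 : wL2 (jweight a 0) (G 0%N) by have := HG 0%N (leq0n m); rewrite mulr0n addr0.
have Hr (r : {poly R}) : (size r <= N.+1)%N ->
    wdot (jweight a 0) (fun x => G 0%N x - q.[x]) (horner r) = 0.
  by rewrite G0; exact: Hq.
have eL2 : wL2 (jweight a 0) (fun x => G 0%N x - q.[x]).
  have mw := @measurable_jweight R a 0 (@Lam R).
  have w_ge0 x : Lam x -> 0 <= jweight a 0 x by move=> _; exact: jweight_ge0.
  exact: (wL2B mw w_ge0 G0L2 (horner_wL2 mw w_ge0 (integrable_jweight a1 (lexx 0)) q)).
(* The chosen representative and [q - G 0] both represent [D^beta (p - u)], so they agree almost
   everywhere. *)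
have E1 : jnorm a 0 (RLderiv beta (p \- u)) = jnorm a 0 (fun x => G 0%N x - q.[x]).
  rewrite jnorm_sym; apply: ae_eq_jnorm.
  - by have [_ [_ [] ]] := RLderivP dpu.
  - by have [_ [_ [] ]] := HB; rewrite G0.
  - by rewrite G0; exact: RLderiv_unique (RLderivP dpu) HB.
eexists; eexists; split; [by rewrite E1; exact: jnormE|exact: jnormE (HG m (leqnn m))| |].
  by apply: wdot_ge0 => x _; exact: jweight_ge0.
exact: (proj_error_iter a1 mN HG HD sq Hr).
Qed.

Lemma sqrt_le_of_mul (c A B : R) : 0 < c -> 0 <= B -> c * A <= B ->
  Num.sqrt A <= Num.sqrt c^-1 * Num.sqrt B.
Proof.
move=> c0 B0 cA; rewrite -sqrtrM ?invr_ge0 ?(ltW c0)// ler_wsqrtr//.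
by rewrite mulrC ler_pdivlMr// mulrC.
Qed.

End Bound.

Theorem theorem4 (R : realType) (alpha beta : R) (m : nat)
    (beta_gt0 : 0 < beta)
    (alpha_gt : - beta - 1 < alpha) (alpha_lt : alpha < -1)
    (alphaNnat : forall k : nat, (0 < k)%N -> - alpha != k%:R) :
  (forall (N : nat) (u p : R -> R),
     (1 <= N)%N -> (m <= N)%N ->
     (forall l : nat, (l <= m)%N ->
        RLderiv_in_L2 (beta + l%:R) u (alpha + beta + l%:R) l%:R) ->
     is_gjf_proj N alpha beta u p ->
     RLderivable beta (p \- u) /\
     (jnorm (alpha + beta) 0 (RLderiv beta (p \- u)%R) <=
      (N%:R `^ (- (m%:R / 2)) *
       Num.sqrt ((N - m + 1)`!%:R / (N + 1)`!%:R))%:E *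
      jnorm (alpha + beta + m%:R) m%:R (RLderiv (beta + m%:R) u))%E)
  /\
  (exists c : nat -> R,
     [/\ forall N, 0 < c N, c @ \oo --> (1 : R) &
       forall (N : nat) (u p : R -> R),
         (1 <= N)%N -> (m <= N)%N ->
         (forall l : nat, (l <= m)%N ->
            RLderiv_in_L2 (beta + l%:R) u (alpha + beta + l%:R) l%:R) ->
         is_gjf_proj N alpha beta u p ->
         (jnorm (alpha + beta) 0 (RLderiv beta (p \- u)%R) <=
          (c N * N%:R ^- m)%:E *
          jnorm (alpha + beta + m%:R) m%:R (RLderiv (beta + m%:R) u))%E]).
Proof.
have a1 : -1 < alpha + beta by lra.
split=> [N u p N1 mN Hu Hp|].
  have [dpu [A [B [-> -> B0 AB]]]] := gjf_proj_error beta_gt0 alpha_gt mN Hu Hp.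
  split=> //; rewrite -EFinM lee_fin.
  have c0 : 0 < N%:R ^+ m * (N.+1 ^_ m)%:R :> R.
    by rewrite mulr_gt0 ?exprn_gt0 ?ltr0n// ffact_gt0 ltnW.
  apply: le_trans (sqrt_le_of_mul c0 B0 AB) _.
  rewrite ler_wpM2r ?sqrtr_ge0// invfM sqrtrM ?invr_ge0 ?exprn_ge0//.
  (* Reads the real power [N^(-m/2)] as the square root of [N^-m]. *)
  rewrite -mulNr powRrM powR_invn// powR12_sqrt ?invr_ge0 ?exprn_ge0//.
  (* [(N+1)!] is the falling factorial times [(N+1-m)!], which cancels the numerator. *)
  rewrite !addn1 -subSn// -(@ffact_fact N.+1 m) 1?ltnW// natrM.
  by rewrite invfM mulrCA mulfV ?mulr1// pnatr_eq0 -lt0n fact_gt0.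
(* Chosen so that [c N * N^-m] is exactly the square root of the reciprocal of [N^m (N+1)^_m]. The
   value [1] for excluded [N] only serves positivity. *)
pose c (N : nat) : R := if (0 < N)%N && (m <= N)%N then
  Num.sqrt (N%:R ^+ m / (N.+1 ^_ m)%:R) else 1.
exists c; split.
- move=> N; rewrite /c; case: ifPn => // /andP[N0 mN].
  by rewrite sqrtr_gt0 divr_gt0 ?exprn_gt0 ?ltr0n// ffact_gt0 ltnW.
- have H : Num.sqrt (N%:R ^+ m / (N.+1 ^_ m)%:R : R) @[N --> \oo] --> (1 : R).
    rewrite -[X in _ --> X]sqrtr1; apply: continuous_cvg; first exact: sqrt_continuous.
    exact: ffact_ratio_cvg1.
  apply: cvg_trans H; apply: near_eq_cvg; near=> N.
  rewrite /c ifT//; apply/andP; split; near: N; [exact: nbhs_infty_gt|exact: nbhs_infty_ge].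
- move=> N u p N1 mN Hu Hp.
  have [dpu [A [B [-> -> B0 AB]]]] := gjf_proj_error beta_gt0 alpha_gt mN Hu Hp.
  rewrite -EFinM lee_fin.
  have Nm : 0 < N%:R ^+ m :> R by rewrite exprn_gt0 ?ltr0n.
  have F0 : 0 < (N.+1 ^_ m)%:R :> R by rewrite ltr0n ffact_gt0 ltnW.
  have c0 : 0 < N%:R ^+ m * (N.+1 ^_ m)%:R :> R by rewrite mulr_gt0.
  apply: le_trans (sqrt_le_of_mul c0 B0 AB) _.
  rewrite ler_wpM2r ?sqrtr_ge0// /c N1 mN/=.
  have eX : N%:R ^- m = Num.sqrt ((N%:R ^- m) ^+ 2) :> R.
    by rewrite sqrtr_sqr ger0_norm// invr_ge0 ltW.
  rewrite eX -sqrtrM ?divr_ge0 ?(ltW Nm) ?(ltW F0)//.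
  rewrite le_eqVlt; apply/orP; left; apply/eqP; congr Num.sqrt.
  by field; rewrite ?gt_eqF.
Unshelve. all: by end_near. Qed.
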